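(* Let $\cdots\to X_{n+1}\to X_n\to\cdots\to X_0$ be a tower of fibrations, let $k\ge0$, and let $x\in X_k$ be a point, taken as base point (together with its images in $X_n$, $n\le k$), such that $H\Bbbk$-module spectra $F_{r,s}$ and structure satisfying the truncated Assumptions (A1)--(A6) of the context are given. Let $l$ be an integer with $\frac{k-1}{2}\le l\le k$. Then the image of $x$ along the map $X_k\to\Omega^{\infty-1}F_{k,1}$ of (A1) represents an element in the term $E^{k+1,k}_{k+1-l}$ of the truncated spectral sequence, and this element vanishes if and only if there exists $y\in X_{k+1}$ such that the image of $y$ along the bonding map $X_{k+1}\to X_l$ coincides with the image of $x$ along $X_k\to X_l$.
   Context: **Tower.** $X_n=*$ for $n<0$; $X_{r,m}$, $r\ge m$, is the (homotopy) fiber of $X_r\to X_m$ (over the base point of $X_m$, for $m\le k$). For $m\le r$, $s\ge0$, $X_{r+s,m}$ is the homotopy pull-back of $X_{r+s}\to X_r\leftarrow X_{r,m}$, and there are homotopy fiber sequences $X_{r+s,r}\to X_{r+s,m}\to X_{r,m}$ (call them (A)), when based. Notation: $\Omega^{-n}F=\Sigma^nF$ and $\Omega^{\infty-n}F=\Omega^\infty\Sigma^nF$. $\Bbbk$ is a commutative ring. **Truncated assumptions.** $H\Bbbk$-module spectra $F_{r,s}$ are given for $r\ge-1$ and $0\le s\le k+2$, with $F_{r,0}\simeq*$ and $F_{r,s}\simeq*$ if $r+s<0$, such that: (A1) For $s\ge0$, $s-2\le m\le r$ and $m\le k$ there are compatible homotopy fiber sequences $X_{r+s,m}\to X_{r,m}\to\Omega^{\infty-1}F_{r,s}$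 (call them (C)) whose first map is the one above; for $s=0,1$ the bound $s-2\le m$ is dropped. In particular $X_{r+s,r}\simeq\Omega^\infty F_{r,s}$ for $s-2\le r$ and $r+s\le k$. (A2) For $s,t\ge0$ with $s+t-2\le k$ there are homotopy fiber sequences of $H\Bbbk$-module spectra $F_{r+s,t}\to F_{r,s+t}\to F_{r,s}$, the first (resp. second) map being the identity for $s=0$ (resp. $t=0$). (A3) For $s,t\ge0$, $s+t-2\le m\le r$ and $m\le k$, the square formed by $X_{r+s,m}\to X_{r,m}\to\Omega^{\infty-1}F_{r,s+t}$ and $X_{r+s,m}\to\Omega^{\infty-1}F_{r+s,t}\to\Omega^{\infty-1}F_{r,s+t}$ commutes up to coherent homotopy, and $X_{r,m}\to\Omega^{\infty-1}F_{r,s}$ is the composite $X_{r,m}\to\Omega^{\infty-1}F_{r,s+t}\to\Omega^{\infty-1}F_{r,s}$. For $s+t-2\le r$ and $r+s+t\le k$, $X_{r+s+t,r}\to X_{r+s,r}\to\Omega^{\infty-1}F_{r+s,t}$ is $\Omega^\infty$ of $F_{r,s+t}\to F_{r,s}\to\Omega^{-1}F_{r+s,t}$. (A4) For $s,t,u\ge0$ with $s+t+u-2\le k$, the maps of (A2) satisfy: the composites $F_{r+s,t+u}\to F_{r,s+t+u}\to F_{r,s+t}$ and $F_{r+s,t+u}\to F_{r+s,t}\to F_{r,s+t}$ agree, $F_{r+s+t,u}\to F_{r,s+t+u}$ is the composite through $F_{r+s,t+u}$, and $F_{r,s+t+u}\to F_{r,s}$ is the composite through $F_{r,s+t}$. (A5)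 For $m\le r\le2m+3$, a weak equivalence $\Omega X_{r,m}\simeq\Omega^{\infty+1}F_{m,r-m}$ is given. If $m\le r$, $s\ge0$, $r+s\le2m+3$, the loop space of (A) is $\Omega^{\infty+1}$ of $F_{r,s}\to F_{m,r+s-m}\to F_{m,r-m}$; if in addition $s-2\le m$ (no bound for $s=0,1$), the loop space of (C) is $\Omega^{\infty+1}$ of $F_{m,r+s-m}\to F_{m,r-m}\to\Omega^{-1}F_{r,s}$, and in particular the loop space of the equivalence in (A1) is the equivalence here. All this under the constraint $r+s\le k$. (A6) For $m\le r$, a weak equivalence $\Omega^2X_{r,m}\simeq\Omega^{\infty+2}F_{m,r-m}$ is given, which is the loop space of that in (A5) when defined; the double loop space of (A) is $\Omega^{\infty+2}$ of $F_{r,s}\to F_{m,r+s-m}\to F_{m,r-m}$, and, if $s-2\le m\le r$ (no lower bound for $s=0,1$), the double loop space of (C) is $\Omega^{\infty+2}$ of $F_{m,r+s-m}\to F_{m,r-m}\to\Omega^{-1}F_{r,s}$. All this under the constraint $r+s\le k$. **Truncated spectral sequence.** For $1\le r\le\frac{k+3}2$, $s\ge2r-3$ and $t\in\mathbb Z$, the term $E_r^{st}$ of the truncated spectral sequence is the homology of the connecting morphisms $\pi_{t-s+1}F_{s-r,r-1}\to\pi_{t-s}F_{s-1,1}\to\pi_{t-s-1}F_{s,r-1}$ of (A2). In particular $E^{k+1,k}_{k+1-l}$ is the homology of $$\pi_0F_{l,k-l}\to\pi_{-1}F_{k,1}\to\pi_{-2}F_{k+1,k-l},$$ and a point of $\Omega^{\infty-1}F_{k,1}$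 determines an element of $\pi_0\Omega^{\infty-1}F_{k,1}=\pi_{-1}F_{k,1}$. *)

(* Defs.v *)
From mathcomp Require Import all_boot all_order all_algebra.
From mathcomp Require Import boolp zify.

Set Implicit Arguments.
Unset Strict Implicit.
Unset Printing Implicit Defensive.

Import Order.TTheory GRing.Theory Num.Theory.
Local Open Scope ring_scope.

(** * Simplicial sets *)

(* [mono m n]: the morphisms [m] -> [n] of the simplex category, that is, the
   m-simplices of Delta^n. *)
Definition mono (m n : nat) :=
  {f : {ffun 'I_m.+1 -> 'I_n.+1} |
    [forall i : 'I_m.+1, forall j : 'I_m.+1, (i <= j)%N ==> (f i <= f j)%N]}.

Definition mono_fun m n (f : mono m n) : 'I_m.+1 -> 'I_n.+1 := val f.
Coercion mono_fun : mono >-> Funclass.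

Lemma mono_ext m n (f g : mono m n) : f =1 g -> f = g.
Proof. by move=> fg; apply/val_inj/ffunP. Qed.

Lemma monoP m n (f : mono m n) (i j : 'I_m.+1) :
  (i <= j)%N -> (f i <= f j)%N.
Proof.
case: f => f fP ij; rewrite /mono_fun /=.
by move/forallP/(_ i)/forallP/(_ j)/implyP: fP; apply.
Qed.

Definition mk_mono m n (f : 'I_m.+1 -> 'I_n.+1)
  (fP : forall i j : 'I_m.+1, (i <= j)%N -> (f i <= f j)%N) : mono m n.
Proof.
exists (finfun f).
by apply/forallP => i; apply/forallP => j; apply/implyP => ij; rewrite !ffunE fP.
Defined.

Definition mid n : mono n n := @mk_mono n n id (fun _ _ => id).

Definition mcomp m n p (g : mono n p) (f : mono m n) : mono m p :=
  @mk_mono m p (fun i => g (f i)) (fun i j ij => monoP g (monoP f ij)).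

Definition mcst m n (i : 'I_n.+1) : mono m n :=
  @mk_mono m n (fun=> i) (fun _ _ _ => leqnn _).

Lemma max_le m (s t : mono m 1) (i j : 'I_m.+1) : (i <= j)%N ->
  ((if s i <= t i then t i else s i) <=
   (if s j <= t j then t j else s j))%N.
Proof.
move=> ij; have := monoP s ij; have := monoP t ij.
by case: ifP; case: ifP; lia.
Qed.

(* pointwise maximum, the contraction of Delta^1 to its vertex 1 *)
Definition mmax m (s t : mono m 1) : mono m 1 :=
  @mk_mono m 1 (fun i => if (s i <= t i)%N then t i else s i) (max_le s t).

Record sset := SSet {
  sx :> nat -> Type;
  sact : forall m n, mono m n -> sx n -> sx m;
  sact_id : forall n x, sact (mid n) x = x;
  sact_comp : forall m n p (g : mono n p) (f : mono m n) x,
    sact (mcomp g f) x = sact f (sact g x) }.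
Arguments sact {s m n} _ _.

Record smap (X Y : sset) := SMap {
  sfun :> forall n, X n -> Y n;
  smapE : forall m n (f : mono m n) x, sfun (sact f x) = sact f (sfun x) }.
Arguments sfun {X Y} _ {n} _.

Definition sid (X : sset) : smap X X := @SMap X X (fun _ x => x) (fun _ _ _ _ => erefl).

Program Definition scomp X Y Z (g : smap Y Z) (f : smap X Y) : smap X Z :=
  @SMap X Z (fun n x => g n (f n x)) _.
Next Obligation. by rewrite !smapE. Qed.

Record psset := PSset { psort :> sset; pt : psort 0 }.

(* the n-simplex degenerate on a vertex, and on the base point *)
Definition deg (X : sset) (v : X 0) n : X n := sact (mcst n ord0) v.
Definition bpt (X : psset) n : X n := deg (pt X) n.

Lemma mcompE m n p (g : mono n p) (f : mono m n) i : mcomp g f i = g (f i).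
Proof. by rewrite /mono_fun /= ffunE. Qed.

Lemma mcstE m n (i : 'I_n.+1) j : mcst m i j = i.
Proof. by rewrite /mono_fun /= ffunE. Qed.

Lemma midE n i : mid n i = i.
Proof. by rewrite /mono_fun /= ffunE. Qed.

Lemma mcompA m n p q (h : mono p q) (g : mono n p) (f : mono m n) :
  mcomp h (mcomp g f) = mcomp (mcomp h g) f.
Proof. by apply: mono_ext => i; rewrite !mcompE. Qed.

Lemma mcompid m n (f : mono m n) : mcomp f (mid m) = f.
Proof. by apply: mono_ext => i; rewrite mcompE midE. Qed.

Lemma midcomp m n (f : mono m n) : mcomp (mid n) f = f.
Proof. by apply: mono_ext => i; rewrite mcompE midE. Qed.

Lemma mcstcomp m n p (i : 'I_p.+1) (f : mono m n) :
  mcomp (mcst n i) f = mcst m i.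
Proof. by apply: mono_ext => j; rewrite mcompE !mcstE. Qed.

Lemma mcompcst m n p (g : mono n p) (i : 'I_n.+1) :
  mcomp g (mcst m i) = mcst m (g i).
Proof. by apply: mono_ext => j; rewrite mcompE !mcstE. Qed.

Lemma mmax_comp m n (s t : mono n 1) (f : mono m n) :
  mcomp (mmax s t) f = mmax (mcomp s f) (mcomp t f).
Proof. by apply: mono_ext => i; rewrite mcompE /mono_fun /= !ffunE -!mcompE. Qed.

Lemma sact_deg (X : sset) (v : X 0) m n (f : mono m n) :
  sact f (deg v n) = deg v m.
Proof. by rewrite /deg -sact_comp mcstcomp. Qed.

Lemma smap_deg (X Y : sset) (f : smap X Y) v n : f n (deg v n) = deg (f 0 v) n.
Proof. by rewrite /deg smapE. Qed.

Program Definition sconst (X : sset) (Y : psset) : smap X Y :=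
  @SMap X Y (fun n _ => bpt Y n) _.
Next Obligation. by rewrite sact_deg. Qed.

Record pmap (X Y : psset) :=
  PMap { pfun :> smap X Y; pmapE : pfun 0 (pt X) = pt Y }.

Lemma pmap_bpt (X Y : psset) (f : pmap X Y) n : f n (bpt X n) = bpt Y n.
Proof. by rewrite smap_deg pmapE. Qed.

Definition pid (X : psset) : pmap X X := @PMap X X (sid X) erefl.

Program Definition pcomp X Y Z (g : pmap Y Z) (f : pmap X Y) : pmap X Z :=
  @PMap X Z (scomp g f) _.
Next Obligation. by rewrite /= !pmapE. Qed.

(* the simplicial subset cut out by P *)
Program Definition ssub (X : sset) (P : forall n, X n -> Prop)
  (hP : forall m n (f : mono m n) x, P n x -> P m (sact f x)) : sset :=
  @SSet (fun n => {x : X n | P n x})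
        (fun m n f x => exist _ (sact f (proj1_sig x)) (hP _ _ f _ (proj2_sig x)))
        _ _.
Next Obligation. by apply: eq_exist; rewrite sact_id. Qed.
Next Obligation. by apply: eq_exist; rewrite sact_comp. Qed.

Program Definition sprod (X Y : sset) : sset :=
  @SSet (fun n => (X n * Y n)%type)
        (fun m n f x => (sact f x.1, sact f x.2)) _ _.
Next Obligation. by rewrite !sact_id. Qed.
Next Obligation. by rewrite !sact_comp. Qed.

Definition point : sset :=
  @SSet (fun=> unit) (fun _ _ _ _ => tt) (fun _ => fun 'tt => erefl)
        (fun _ _ _ _ _ _ => erefl).

Definition to_point (X : sset) : smap X point :=
  @SMap X point (fun _ _ => tt) (fun _ _ _ _ => erefl).

(** * Kan complexes, homotopies, path spaces *)

(* [in_horn i s]: s lies in the horn Lambda^n_i *)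
Definition in_horn m n (i : 'I_n.+1) (s : mono m n) : bool :=
  [exists j, (j != i) && [forall a, s a != j]].

Definition kan_fib (X Y : sset) (p : smap X Y) : Prop :=
  forall n (i : 'I_n.+2)
    (u : forall m (s : mono m n.+1), in_horn i s -> X m) (y : Y n.+1),
    (forall m m' (f : mono m' m) s (h : in_horn i s) (h' : in_horn i (mcomp s f)),
       u m' (mcomp s f) h' = sact f (u m s h)) ->
    (forall m s (h : in_horn i s), p m (u m s h) = sact s y) ->
  exists2 x : X n.+1,
    forall m s (h : in_horn i s), sact s x = u m s h & p n.+1 x = y.

Definition kan (X : sset) : Prop := kan_fib (to_point X).

(* [htpy f g]: a homotopy X x Delta^1 -> Y from f to g *)
Record htpy (X Y : sset) (f g : smap X Y) := Htpy {
  hfun :> forall n, X n -> mono n 1 -> Y n;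
  htpyE : forall m n (a : mono m n) x t,
    hfun (sact a x) (mcomp t a) = sact a (hfun x t);
  htpy0 : forall n x, hfun x (mcst n ord0) = f n x;
  htpy1 : forall n x, hfun x (mcst n ord_max) = g n x }.

(* In a Kan complex [homotopic] is an equivalence relation, and a map between
   Kan complexes is a weak equivalence if and only if it is a homotopy
   equivalence.  All the spaces below are Kan complexes. *)
Definition homotopic (X Y : sset) (f g : smap X Y) : Prop := inhabited (htpy f g).

Definition weq (X Y : sset) (f : smap X Y) : Prop :=
  exists g : smap Y X, homotopic (scomp g f) (sid X) /\ homotopic (scomp f g) (sid Y).

Definition contractible (X : sset) : Prop := weq (to_point X).

Definition based (X Y : psset) (f g : smap X Y) (H : htpy f g) : Prop :=
  forall n t, H n (bpt X n) t = bpt Y n.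

Definition stationary (X Y : sset) (f g : smap X Y) (H : htpy f g) : Prop :=
  forall n x t, H n x t = f n x.

(* the n-simplices Delta^n x Delta^1 -> Y of the path space *)
Record path (Y : sset) (n : nat) := Path {
  pathf :> forall p, mono p n -> mono p 1 -> Y p;
  pathE : forall p q (f : mono p q) s t,
    pathf (mcomp s f) (mcomp t f) = sact f (pathf s t) }.

Lemma path_ext (Y : sset) n (c d : path Y n) :
  (forall p s t, c p s t = d p s t) -> c = d.
Proof.
case: c d => c cE [d dE] /= cd.
have ecd : c = d.
  apply: functional_extensionality_dep => p.
  by apply/funext => s; apply/funext => t; apply: cd.
by case: _ / ecd dE {cd} => dE; rewrite (Prop_irrelevance cE dE).
Qed.

Program Definition path_act (Y : sset) m n (f : mono m n) (c : path Y n) :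
    path Y m :=
  @Path Y m (fun p s t => c p (mcomp f s) t) _.
Next Obligation. by rewrite mcompA pathE. Qed.

Program Definition paths (Y : sset) : sset := @SSet (path Y) (@path_act Y) _ _.
Next Obligation. by apply: path_ext => p s t /=; rewrite midcomp. Qed.
Next Obligation. by apply: path_ext => q s t /=; rewrite mcompA. Qed.

Definition pend (Y : sset) (i : 'I_2) n (c : path Y n) : Y n :=
  c n (mid n) (mcst n i).

Lemma pendE (Y : sset) i m n (f : mono m n) (c : path Y n) :
  pend i (path_act f c) = sact f (pend i c).
Proof. by rewrite /pend /= -pathE mcompid midcomp mcstcomp. Qed.

Program Definition cpath (Y : psset) n : path Y n :=
  @Path Y n (fun p _ _ => bpt Y p) _.
Next Obligation. by rewrite sact_deg. Qed.

(* vertices of Y lying in the same component *)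
Definition connected (Y : sset) (v w : Y 0) : Prop :=
  exists e : Y 1, sact (mcst 0 ord0) e = v /\ sact (mcst 0 ord_max) e = w.

Program Definition hpath (X Y : sset) (f g : smap X Y) (H : htpy f g) n (x : X n) :
    path Y n :=
  @Path Y n (fun p s t => H p (sact s x) t) _.
Next Obligation. by rewrite sact_comp htpyE. Qed.

(** * Loop spaces and homotopy fibres *)

Definition is_loop (Y : psset) n (c : paths Y n) : Prop :=
  pend ord0 c = bpt Y n /\ pend ord_max c = bpt Y n.

Lemma is_loop_act (Y : psset) m n (f : mono m n) (c : paths Y n) :
  is_loop c -> is_loop (sact f c).
Proof. by case=> c0 c1; split; rewrite [LHS]pendE ?c0 ?c1 sact_deg. Qed.

Lemma is_loop_cpath (Y : psset) n : is_loop (cpath Y n : paths Y n).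
Proof. by []. Qed.

Definition loop (Y : psset) : psset :=
  @PSset (ssub (@is_loop_act Y)) (exist _ (cpath Y 0) (is_loop_cpath Y 0)).

Lemma bpt_loop (Y : psset) n : sval (bpt (loop Y) n) = cpath Y n.
Proof. exact: path_ext. Qed.

(* loops are determined by their underlying paths *)
Lemma loop_ext (Y : psset) n (c d : loop Y n) :
  (forall p s t, sval c p s t = sval d p s t) -> c = d.
Proof. by case: c d => c cP [d dP] cd; apply: eq_exist; apply: path_ext. Qed.

Program Definition path_map (X Y : sset) (f : smap X Y) n (c : path X n) : path Y n :=
  @Path Y n (fun p s t => f p (c p s t)) _.
Next Obligation. by rewrite pathE smapE. Qed.

Lemma loop_map_subproof (X Y : psset) (f : pmap X Y) n (c : loop X n) :
  is_loop (path_map f (sval c) : paths Y n).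
Proof.
case: c => c [c0 c1]; rewrite /is_loop /pend /=.
by split; [move: c0|move: c1]; rewrite /pend => ->; rewrite pmap_bpt.
Qed.

Program Definition loop_map (X Y : psset) (f : pmap X Y) : pmap (loop X) (loop Y) :=
  @PMap (loop X) (loop Y)
    (@SMap (loop X) (loop Y)
       (fun n c => exist _ (path_map f (sval c)) (loop_map_subproof f c)) _) _.
Next Obligation. by apply: loop_ext. Qed.
Next Obligation. by apply: loop_ext => p s t /=; rewrite pmap_bpt. Qed.

(* the homotopy fibre of p : E -> B over the base point: simplices of E with a
   path from their image to the base point *)
Definition in_hofib (E : sset) (B : psset) (p : smap E B) n
    (z : sprod E (paths B) n) : Prop :=
  pend ord0 z.2 = p n z.1 /\ pend ord_max z.2 = bpt B n.

Lemma in_hofib_act (E : sset) (B : psset) (p : smap E B) m n (f : mono m n) z :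
  in_hofib p z -> in_hofib p (sact f z).
Proof. by case=> z0 z1; split; rewrite [LHS]pendE ?z0 ?z1 ?smapE ?sact_deg. Qed.

Definition hofib (E : sset) (B : psset) (p : smap E B) : sset :=
  ssub (@in_hofib_act E B p).

Lemma hofib_ext (E : sset) (B : psset) (p : smap E B) n (y z : hofib p n) :
  (sval y).1 = (sval z).1 ->
  (forall q s t, (sval y).2 q s t = (sval z).2 q s t) -> y = z.
Proof.
case: y z => -[y c] yP [[z d] zP] /= yz cd; apply: eq_exist.
by rewrite yz (path_ext cd).
Qed.

Lemma deg0 (X : sset) (v : X 0) : deg v 0 = v.
Proof.
rewrite /deg -[RHS]sact_id; congr (sact _ v).
by apply: mono_ext => i; rewrite mcstE midE !ord1.
Qed.

Lemma sact0 (X : sset) (v : X 0) n (s : mono n 0) : sact s v = deg v n.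
Proof. by congr (sact _ v); apply: mono_ext => i; rewrite !ord1. Qed.

Lemma in_hofib_pt (E B : psset) (p : pmap E B) :
  in_hofib p ((pt E, cpath B 0) : sprod E (paths B) 0).
Proof. by split=> //=; rewrite pmapE; exact: deg0. Qed.

Definition phofib (E B : psset) (p : pmap E B) : psset :=
  @PSset (hofib p) (exist _ _ (in_hofib_pt p)).

(* the map to the homotopy fibre determined by a null homotopy of p i *)
Lemma fibmap_subproof (F E : sset) (B : psset) (i : smap F E) (p : smap E B)
  (h : htpy (scomp p i) (sconst F B)) n (x : F n) :
  in_hofib p ((i n x, hpath h x) : sprod E (paths B) n).
Proof. by split; rewrite /= /pend /= ?sact_id ?htpy0 ?htpy1. Qed.

Program Definition fibmap (F E : sset) (B : psset) (i : smap F E) (p : smap E B)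
    (h : htpy (scomp p i) (sconst F B)) : smap F (hofib p) :=
  @SMap F (hofib p) (fun n x => exist _ _ (fibmap_subproof h x)) _.
Next Obligation.
by apply: hofib_ext => [|q s t] /=; rewrite ?smapE // -sact_comp.
Qed.

(* F -> E -> B with null homotopy h is a homotopy fibre sequence *)
Definition fibre_seq (F E : sset) (B : psset) (i : smap F E) (p : smap E B)
  (h : htpy (scomp p i) (sconst F B)) : Prop := weq (fibmap h).

Record pnull (F E B : psset) (i : pmap F E) (p : pmap E B) := PNull {
  pnullh :> htpy (scomp p i) (sconst F B);
  pnullb : based pnullh }.

Program Definition pfibmap (F E B : psset) (i : pmap F E) (p : pmap E B)
    (h : pnull i p) : pmap F (phofib p) :=
  @PMap F (phofib p) (fibmap h) _.
Next Obligation.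
apply: hofib_ext => [|q s t] /=; first exact: pmapE.
by rewrite sact0 pnullb.
Qed.

Program Definition loop_null_path (F E B : psset) (i : pmap F E) (p : pmap E B)
    (h : pnull i p) n (c : loop F n) (t : mono n 1) : path B n :=
  @Path B n (fun q s u => h q (sval c q s u) (mcomp t s)) _.
Next Obligation. by rewrite pathE mcompA htpyE. Qed.

Lemma loop_null_subproof (F E B : psset) (i : pmap F E) (p : pmap E B)
  (h : pnull i p) n (c : loop F n) (t : mono n 1) :
  is_loop (loop_null_path h c t : paths B n).
Proof.
case: c => c [c0 c1]; split; rewrite /pend /=.
  by rewrite -[c n _ _]/(pend ord0 c) c0 pnullb.
by rewrite -[c n _ _]/(pend ord_max c) c1 pnullb.
Qed.

(* the loop space of a null homotopic composite *)
Program Definition loop_null (F E B : psset) (i : pmap F E) (p : pmap E B)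
    (h : pnull i p) : pnull (loop_map i) (loop_map p) :=
  @PNull _ _ _ (loop_map i) (loop_map p)
    (@Htpy (loop F) (loop B) (scomp (loop_map p) (loop_map i)) (sconst _ _)
      (fun n c t => exist _ (loop_null_path h c t) (loop_null_subproof h c t))
      _ _ _) _.
Next Obligation. by apply: loop_ext => q s u /=; rewrite mcompA. Qed.
Next Obligation. by apply: loop_ext => q s u /=; rewrite mcstcomp htpy0. Qed.
Next Obligation. by apply: loop_ext => q s u /=; rewrite mcstcomp htpy1. Qed.
Next Obligation.
move=> n t; apply: loop_ext => q s u /=; rewrite pnullb.
by rewrite -/(deg _ _).
Qed.

Lemma hinc_subproof (B C : psset) (q : pmap B C) n (c : loop C n) :
  in_hofib q ((bpt B n, sval c) : sprod B (paths C) n).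
Proof. by case: c => c [c0 c1]; split; rewrite //= c0 pmap_bpt. Qed.

(* the connecting map from the loops of C to the homotopy fibre of q : B -> C *)
Program Definition hinc (B C : psset) (q : pmap B C) : pmap (loop C) (phofib q) :=
  @PMap (loop C) (phofib q)
    (@SMap (loop C) (hofib q) (fun n c => exist _ _ (hinc_subproof q c)) _) _.
Next Obligation. by apply: hofib_ext => [|p s t] //=; rewrite sact_deg. Qed.
Next Obligation. by apply: hofib_ext => [|p s t] //=; rewrite /bpt deg0. Qed.

Program Definition rot_path (B C : psset) (q : pmap B C) n (c : loop B n)
    (t : mono n 1) : path C n :=
  @Path C n (fun m s u => q m (sval c m s (mmax u (mcomp t s)))) _.
Next Obligation. by rewrite mcompA -mmax_comp pathE smapE. Qed.

Lemma mmax0 n (t : mono n 1) : mmax (mcst n ord0) t = t.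
Proof. by apply: mono_ext => i; rewrite /mono_fun /= ffunE mcstE. Qed.

Lemma mmaxr0 n (t : mono n 1) : mmax t (mcst n ord0) = t.
Proof.
apply: mono_ext => i; rewrite /mono_fun /= ffunE mcstE leqn0.
by case: eqP => // ti; apply: val_inj.
Qed.

Lemma mmax1 n (t : mono n 1) : mmax (mcst n ord_max) t = mcst n ord_max.
Proof.
apply: mono_ext => i; rewrite {1}/mono_fun /= ffunE !mcstE.
by case: ifP => // ti; apply: val_inj => /=; move: ti (ltn_ord (t i)) => /=; lia.
Qed.

Lemma mmaxr1 n (t : mono n 1) : mmax t (mcst n ord_max) = mcst n ord_max.
Proof.
apply: mono_ext => i; rewrite {1}/mono_fun /= ffunE !mcstE.
by case: ifP => // ti; apply: val_inj => /=; move: ti (ltn_ord (t i)) => /=; lia.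
Qed.

Lemma rot_subproof (B C : psset) (q : pmap B C) n (c : loop B n) (t : mono n 1) :
  in_hofib q ((sval c n (mid n) t, rot_path q c t) : sprod B (paths C) n).
Proof.
split; rewrite /= /pend /= mcompid ?mmax0 ?mmax1 //.
by case: c => c [_ c1] /=; rewrite -[c n _ _]/(pend ord_max c) c1 pmap_bpt.
Qed.

(* The composite loop B -> loop C -> hofib q is null: a loop c in B is moved to
   the base point along its remaining part, which contracts q c. *)
Program Definition rot (B C : psset) (q : pmap B C) : pnull (loop_map q) (hinc q) :=
  @PNull _ _ _ (loop_map q) (hinc q)
    (@Htpy (loop B) (hofib q) (scomp (hinc q) (loop_map q)) (sconst _ (phofib q))
      (fun n c t => exist _ _ (rot_subproof q c t)) _ _ _) _.
Next Obligation.
apply: hofib_ext => [|r s u] /=; last by rewrite mcompA.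
by rewrite -pathE mcompid midcomp.
Qed.
Next Obligation.
apply: hofib_ext => [|r s u] /=; last by rewrite mcstcomp mmaxr0.
have [x0 _] := H; exact: x0.
Qed.
Next Obligation.
have [_ x1] := H; apply: hofib_ext => [|r s u] /=.
  by rewrite -[LHS]/(pend ord_max x) x1.
rewrite mcstcomp mmaxr1 -[mcst r _](mcstcomp _ s) -{1}[s]midcomp pathE.
by rewrite -[x n _ _]/(pend ord_max x) x1 smapE pmap_bpt -/(deg _ _) sact_deg.
Qed.
Next Obligation.
move=> n t; apply: hofib_ext => [|r s u] //=; rewrite ?pmap_bpt //.
Qed.

(** * Coherent maps of null homotopic composites *)

(* Two null homotopic composites F -> E -> B and F' -> E' -> B', maps a, b, c
   between them, and homotopies L, K filling the two squares.  A filler is a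
   homotopy of null homotopies between  p' b i ~ c p i ~ *  and
   p' b i ~ p' i' a ~ *. *)
Record filler (F E : sset) (B : psset) (i : smap F E) (p : smap E B)
    (h : htpy (scomp p i) (sconst F B))
    (F' E' : sset) (B' : psset) (i' : smap F' E') (p' : smap E' B')
    (h' : htpy (scomp p' i') (sconst F' B'))
    (a : smap F F') (b : smap E E') (c : pmap B B')
    (L : htpy (scomp p' b) (scomp c p)) (K : htpy (scomp b i) (scomp i' a)) :=
  Filler {
    fillf :> forall n, F n -> mono n 1 -> mono n 1 -> B' n;
    fillE : forall m n (f : mono m n) x s t,
      fillf (sact f x) (mcomp s f) (mcomp t f) = sact f (fillf x s t);
    fill_L : forall n x s, fillf x s (mcst n ord0) = L n (i n x) s;
    fill_h : forall n x t, fillf x (mcst n ord_max) t = c n (h n x t);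
    fill_K : forall n x t, fillf x (mcst n ord0) t = p' n (K n x t);
    fill_h' : forall n x s, fillf x s (mcst n ord_max) = h' n (a n x) s }.

Definition coherent (F E : sset) (B : psset) (i : smap F E) (p : smap E B)
    (h : htpy (scomp p i) (sconst F B))
    (F' E' : sset) (B' : psset) (i' : smap F' E') (p' : smap E' B')
    (h' : htpy (scomp p' i') (sconst F' B'))
    (a : smap F F') (b : smap E E') (c : pmap B B')
    (L : htpy (scomp p' b) (scomp c p)) (K : htpy (scomp b i) (scomp i' a)) : Prop :=
  inhabited (filler h h' L K).

(* the same in pointed simplicial sets *)
Definition pcoherent (F E B : psset) (i : pmap F E) (p : pmap E B) (h : pnull i p)
    (F' E' B' : psset) (i' : pmap F' E') (p' : pmap E' B') (h' : pnull i' p')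
    (a : pmap F F') (b : pmap E E') (c : pmap B B') : Prop :=
  exists (L : htpy (scomp p' b) (scomp c p)) (K : htpy (scomp b i) (scomp i' a))
    (Q : filler h h' L K),
    [/\ based L, based K & forall n s t, Q n (bpt F n) s t = bpt B' n].

Definition phomotopic (X Y : psset) (f g : pmap X Y) : Prop :=
  exists H : htpy f g, based H.

(** * Module spectra over the Eilenberg-MacLane ring spectrum *)

(* the simplices of S^1 = Delta^1 / (boundary) other than the base point *)
Definition in_circle n (s : mono n 1) : bool :=
  (s ord0 == ord0) && (s ord_max == ord_max).
Definition circle n := {s : mono n 1 | in_circle s}.

(* For a finite set A, the space (HK)_A is the reduced K-linearization of the
   smash power S^A of the circle: a simplex is a K-valued function on the
   simplices of S^A other than the base point. *)
Definition HK (K : comPzRingType) (A : finType) (n : nat) :=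
  {ffun {ffun A -> circle n} -> K}.

Section HK.
Variable K : comPzRingType.

Definition HK0 (A : finType) n : HK K A n := [ffun=> 0].

Definition HKact (A : finType) m n (f : mono m n) (u : HK K A n) : HK K A m :=
  [ffun t : {ffun A -> circle m} =>
     \sum_(s : {ffun A -> circle n} | [forall a, mcomp (val (s a)) f == val (t a)]) u s].

Definition HKperm (A B : finType) (f : A -> B) n (u : HK K A n) : HK K B n :=
  [ffun t : {ffun B -> circle n} => u [ffun a => t (f a)]].

Definition HKmul (A B : finType) n (u : HK K A n) (v : HK K B n) :
    HK K (A + B)%type n :=
  [ffun t : {ffun A + B -> circle n} =>
     u [ffun a => t (inl a)] * v [ffun b => t (inr b)]].

Definition HKone n : HK K void n := [ffun=> 1].

(* the unit map S^1 -> (HK)_1; it sends the base point to 0 *)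
Definition HKunit n (s : mono n 1) : HK K unit n :=
  [ffun t : {ffun unit -> circle n} => (val (t tt) == s)%:R].

End HK.

Definition sum_map (A A' B B' : Type) (f : A -> A') (g : B -> B') (z : A + B) :
    A' + B' :=
  match z with inl a => inl (f a) | inr b => inr (g b) end.

Definition sum_assoc (A B C : Type) (z : A + (B + C)) : (A + B) + C :=
  match z with
  | inl a => inl (inl a)
  | inr (inl b) => inl (inr b)
  | inr (inr c) => inr c
  end.

(* HK-modules in symmetric spectra of simplicial sets, in the coordinate free
   form where the levels are indexed by finite sets and bijections (the n-th
   level, with its action of the symmetric group, is the value at a set with n
   elements). *)
Record pre_module (K : comPzRingType) := PreModule {
  lev :> finType -> psset;
  mperm : forall (A B : finType) (f : A -> B), bijective f -> pmap (lev A) (lev B);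
  mperm_id : forall (A : finType) (h : bijective (@id A)) n x, mperm h n x = x;
  mperm_comp : forall (A B C : finType) (f : A -> B) (g : B -> C)
    (hf : bijective f) (hg : bijective g) (h : bijective (g \o f)) n x,
    mperm h n x = mperm hg n (mperm hf n x);
  mact : forall (A B : finType) n, HK K A n -> lev B n -> lev (A + B)%type n;
  mactE : forall (A B : finType) m n (f : mono m n) (u : HK K A n) (x : lev B n),
    mact (HKact f u) (sact f x) = sact f (mact u x);
  mact_perm : forall (A A' B B' : finType) (f : A -> A') (g : B -> B')
    (hf : bijective f) (hg : bijective g) (h : bijective (sum_map f g))
    n (u : HK K A n) (x : lev B n),
    mact (HKperm f u) (mperm hg n x) = mperm h n (mact u x);
  mact0l : forall (A B : finType) n (x : lev B n), mact (HK0 K A n) x = bpt _ n;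
  mact0r : forall (A B : finType) n (u : HK K A n), mact u (bpt (lev B) n) = bpt _ n;
  mact1 : forall (B : finType) (h : bijective (@inr void B)) n (x : lev B n),
    mact (HKone K n) x = mperm h n x;
  mactA : forall (A B C : finType) (h : bijective (@sum_assoc A B C))
    n (u : HK K A n) (v : HK K B n) (x : lev C n),
    mact (HKmul u v) x = mperm h n (mact u (mact v x)) }.
Arguments mact {K p A B n} _ _.

Section Adjoint.
Variables (K : comPzRingType).

Lemma in_circle_cst n (i : 'I_2) : ~~ in_circle (mcst n i).
Proof.
by rewrite /in_circle !mcstE; case: i => -[|[|]] // h; apply/negP => /andP[].
Qed.

Lemma notin_circle n (s : mono n 1) : ~~ in_circle s -> exists i, s = mcst n i.
Proof.
rewrite negb_and => /orP[] h.
  exists ord_max; apply: mono_ext => j; rewrite mcstE.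
  have := monoP s (leq0n j : (@ord0 n <= j)%N).
  by move: h (ltn_ord (s j)); rewrite -!val_eqE /= => *; apply: val_inj => /=; lia.
exists ord0; apply: mono_ext => j; rewrite mcstE.
have := monoP s (leq_ord j : (j <= @ord_max n)%N).
move: h (ltn_ord (s ord_max)); rewrite -!val_eqE /= => *; apply: val_inj => /=; lia.
Qed.

Lemma HKunit_cst n (i : 'I_2) : HKunit K (mcst n i) = HK0 K unit n.
Proof.
apply/ffunP => t; rewrite !ffunE; case: eqP => // ti.
by move: (valP (t tt)) (in_circle_cst n i); rewrite ti => ->.
Qed.

Lemma HKunitE m n (f : mono m n) (s : mono n 1) :
  HKact f (HKunit K s) = HKunit K (mcomp s f).
Proof.
have [s1|/notin_circle[i ->]] := boolP (in_circle s); last first.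
  rewrite mcstcomp !HKunit_cst; apply/ffunP => t; rewrite !ffunE.
  by rewrite big1 // => u _; rewrite ffunE.
apply/ffunP => t; rewrite !ffunE big_mkcond /=.
pose u0 : {ffun unit -> circle n} := [ffun=> exist _ s s1].
rewrite (bigD1 u0) //= big1 => [|u uN0]; last first.
  rewrite ffunE; case: eqP => [us|]; last by rewrite if_same.
  case/eqP: uN0; apply/ffunP => -[]; apply: val_inj.
  by rewrite us ffunE.
rewrite addr0 !ffunE eqxx eq_sym.
have -> : [forall a, mcomp (val (u0 a)) f == val (t a)] = (mcomp s f == val (t tt)).
  apply/forallP/eqP => [/(_ tt)/eqP|tE []]; rewrite ffunE //=.
  by rewrite tE.
by case: eqP.
Qed.

(* the adjoint M_B -> loop M_(1 + B) of the action of S^1 *)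
Variables (M : pre_module K) (B : finType).

Program Definition adj_path n (x : M B n) : path (M (unit + B)%type) n :=
  @Path _ n (fun p s t => mact (HKunit K t) (sact s x)) _.
Next Obligation. by rewrite sact_comp -mactE HKunitE. Qed.

Lemma adj_subproof n (x : M B n) : is_loop (adj_path x : paths _ n).
Proof. by split; rewrite /pend /= HKunit_cst mact0l. Qed.

Program Definition adj : pmap (M B) (loop (M (unit + B)%type)) :=
  @PMap (M B) (loop _)
    (@SMap (M B) (loop _) (fun n x => exist _ (adj_path x) (adj_subproof x)) _) _.
Next Obligation. by apply: loop_ext => p s t /=; rewrite sact_comp. Qed.
Next Obligation. by apply: loop_ext => p s t /=; rewrite sact0 mact0r. Qed.

End Adjoint.

(* Module spectra are represented by HK-modules whose underlying symmetric
   spectrum is an Omega-spectrum of Kan complexes, so that weak equivalences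
   and homotopy fibres are computed levelwise, Omega^(infty-n) M is the n-th
   level for n >= 0, and homotopy groups need no colimit. *)
Record hkmodule (K : comPzRingType) := HKModule {
  hkpre :> pre_module K;
  hk_kan : forall A, kan (hkpre A);
  hk_omega : forall B, weq (adj hkpre B) }.

Definition mcontractible (K : comPzRingType) (M : hkmodule K) : Prop :=
  forall A, contractible (M A).

Record mmap (K : comPzRingType) (M N : hkmodule K) := MMap {
  mfun :> forall A, pmap (M A) (N A);
  mmap_perm : forall (A B : finType) (f : A -> B) (hf : bijective f) n (x : M A n),
    mfun B n (mperm M hf n x) = mperm N hf n (mfun A n x);
  mmap_act : forall (A B : finType) n (u : HK K A n) (x : M B n),
    mfun (A + B)%type n (mact u x) = mact u (mfun B n x) }.

(* a levelwise homotopy M x Delta^1 -> N is a homotopy of HK-modules *)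
Definition mlinear (K : comPzRingType) (M N : hkmodule K)
    (f g : forall A, smap (M A) (N A)) (H : forall A, htpy (f A) (g A)) : Prop :=
  [/\ forall A, based (H A),
      forall (A B : finType) (h : A -> B) (hh : bijective h) n (x : M A n) t,
        H B n (mperm M hh n x) t = mperm N hh n (H A n x t)
    & forall (A B : finType) n (u : HK K A n) (x : M B n) t,
        H (A + B)%type n (mact u x) t = mact u (H B n x t)].

Definition mhomotopic (K : comPzRingType) (M N : hkmodule K)
    (f g : forall A, smap (M A) (N A)) : Prop :=
  exists H : forall A, htpy (f A) (g A), mlinear H.

(* homotopy fibre sequences F -> E -> B of HK-modules *)
Record mfibseq (K : comPzRingType) (F E B : hkmodule K) := MFibSeq {
  mi : mmap F E;
  mp : mmap E B;
  mh : forall A, htpy (scomp (mp A) (mi A)) (sconst (F A) (B A));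
  mh_linear : mlinear mh;
  mh_fibre : forall A, fibre_seq (mh A) }.

Definition mlevel (K : comPzRingType) (F E B : hkmodule K) (S : mfibseq F E B)
  (A : finType) : pnull (mi S A) (mp S A) :=
  @PNull _ _ _ (mi S A) (mp S A) (mh S A)
    (let: And3 h _ _ := mh_linear S in h A).

(** * Stable homotopy groups and connecting morphisms *)

Fixpoint fin (q : nat) : finType := if q is q'.+1 then (unit + fin q')%type else void.

Fixpoint loops (j : nat) (X : psset) : psset :=
  if j is j'.+1 then loop (loops j' X) else X.

Fixpoint loops_map (j : nat) (X Y : psset) (f : pmap X Y) :
    pmap (loops j X) (loops j Y) :=
  match j with 0%N => f | j'.+1 => loop_map (loops_map j' f) end.

Fixpoint loops_null (j : nat) (F E B : psset) (i : pmap F E) (p : pmap E B)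
    (h : pnull i p) : pnull (loops_map j i) (loops_map j p) :=
  match j with 0%N => h | j'.+1 => loop_null (loops_null j' h) end.

Definition mcoface n (i : 'I_n.+2) : mono n n.+1 :=
  @mk_mono n n.+1 (lift i) (fun j k jk => etrans (leq_bump2 i j k) jk).

(* the edge underlying a vertex of a loop space *)
Definition loop_edge (Y : psset) (c : loop Y 0) : Y 1 :=
  sval c 1 (mcst 1 ord0) (mid 1).

Section Stable.
Variable K : comPzRingType.

(* Omega^(infty + n) M *)
Definition Oinf (n : int) (M : hkmodule K) : psset :=
  match n with Posz j => loops j (M (fin 0)) | Negz q => M (fin q.+1) end.

Definition Oinf_map (n : int) (M N : hkmodule K) (f : mmap M N) :
    pmap (Oinf n M) (Oinf n N) :=
  match n with Posz j => loops_map j (f (fin 0)) | Negz q => f (fin q.+1) end.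

Definition Oinf_null (n : int) (F E B : hkmodule K) (S : mfibseq F E B) :
    pnull (Oinf_map n (mi S)) (Oinf_map n (mp S)) :=
  match n with
  | Posz j => loops_null j (mlevel S (fin 0))
  | Negz q => mlevel S (fin q.+1)
  end.

(* n - 1, in a form that computes *)
Definition ipred (n : int) : int :=
  match n with Posz j.+1 => Posz j | Posz 0 => Negz 0 | Negz q => Negz q.+1 end.

Lemma ipredE n : ipred n = n - 1.
Proof. by case: n => [[|j]|q] /=; lia. Qed.

(* the equivalence between Omega^(infty + n) M and the loops of
   Omega^(infty + n - 1) M *)
Definition Oinf_loop (n : int) (M : hkmodule K) :
    pmap (Oinf n M) (loop (Oinf (ipred n) M)) :=
  match n with
  | Posz j.+1 => pid _
  | Posz 0 => adj M (fin 0)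
  | Negz q => adj M (fin q.+1)
  end.

(* pi_n M is the set of components of Omega^(infty + n) M: its elements are
   represented by vertices, and [connected] vertices represent the same one. *)

(* [u] + [v] = [w] in pi_n M, as the fundamental group of Omega^(infty + n - 1) M *)
Definition pi_sum (n : int) (M : hkmodule K) (u v w : Oinf n M 0) : Prop :=
  exists z : Oinf (ipred n) M 2,
    [/\ sact (@mcoface 1 (inord 2)) z = loop_edge (Oinf_loop n M 0 u),
        sact (@mcoface 1 (inord 0)) z = loop_edge (Oinf_loop n M 0 v)
      & sact (@mcoface 1 (inord 1)) z = loop_edge (Oinf_loop n M 0 w)].

(* The connecting morphism pi_n B -> pi_(n-1) F of F -> E -> B maps [u] to [v]:
   in Omega^(infty + n - 1) the images of u and v in the homotopy fibre of
   E -> B, by the maps from the loops of B and from F, can be joined. *)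
Definition conn (n : int) (F E B : hkmodule K) (S : mfibseq F E B)
    (u : Oinf n B 0) (v : Oinf (ipred n) F 0) : Prop :=
  connected (hinc (Oinf_map (ipred n) (mp S)) 0 (Oinf_loop n B 0 u))
            (pfibmap (Oinf_null (ipred n) S) 0 v).

(* The homology of  pi_n B -> pi_(n-1) F -> pi_(n-2) F'  for the connecting
   morphisms of S : F -> E -> B and S' : F' -> E' -> F.  An element is given by
   a cycle; [heq] is equality in the quotient. *)
Record homology (n : int) (F E B F' E' : hkmodule K)
    (S : mfibseq F E B) (S' : mfibseq F' E' F) := Homology {
  hrep :> Oinf (ipred n) F 0;
  hcycle : conn S' hrep (pt (Oinf (ipred (ipred n)) F')) }.

Section Homology.
Variables (n : int) (F E B F' E' : hkmodule K).
Variables (S : mfibseq F E B) (S' : mfibseq F' E' F).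

Definition heq (c c' : homology n S S') : Prop :=
  exists (u : Oinf n B 0) (v : Oinf (ipred n) F 0),
    conn S u v /\ pi_sum v (hrep c') (hrep c).

Lemma hzero_subproof :
  conn S' (pt (Oinf (ipred n) F)) (pt (Oinf (ipred (ipred n)) F')).
Proof.
rewrite /conn !pmapE; exists (bpt (phofib (Oinf_map (ipred (ipred n)) (mp S'))) 1).
by rewrite !sact_deg !deg0.
Qed.

Definition hzero : homology n S S' := Homology S hzero_subproof.

End Homology.
End Stable.

(** * Towers of fibrations *)

Record tower := Tower {
  tw :> int -> sset;
  bond : forall r m : int, m <= r -> smap (tw r) (tw m);
  bond_id : forall r (h : r <= r) n x, bond h n x = x;
  bond_comp : forall r s m (h : s <= r) (h' : m <= s) (h'' : m <= r) n x,
    bond h'' n x = bond h' n (bond h n x);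
  bond_fib : forall r (h : r <= r + 1), kan_fib (bond h);
  tw_neg : forall r : int, r < 0 -> forall n, exists x : tw r n, forall y, y = x }.
Arguments bond {t r m} _.

Section Tower.
Variables (T : tower) (k : int) (x : T k 0).

(* The fibre X_(r,m) of X_r -> X_m over the image of x, for m <= r and m <= k.
   As the bonding maps are fibrations this is the homotopy fibre, and
   X_(r',m) is the (homotopy) pull-back of X_r' -> X_r <- X_(r,m). *)
Definition in_fibre (r m : int) n (z : T r n) : Prop :=
  forall (h : m <= r) (h' : m <= k), bond h n z = deg (bond h' 0 x) n.

Lemma in_fibre_act (r m : int) a b (f : mono a b) (z : T r b) :
  in_fibre m z -> in_fibre m (sact f z).
Proof. by move=> zP h h'; rewrite smapE (zP h h') sact_deg. Qed.

Definition fibre (r m : int) : sset := ssub (@in_fibre_act r m).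

(* the base point of X_r *)
Lemma base_subproof (r m : int) (hr : r <= k) : in_fibre m (bond hr 0 x).
Proof. by move=> h h'; rewrite deg0 -bond_comp. Qed.

(* X_(r,m) with its base point; X_(r,m) = X_r for m < 0 *)
Definition pfibre (r m : int) (hr : r <= k) : psset :=
  @PSset (fibre r m) (exist _ _ (@base_subproof r m hr)).

(* the canonical maps X_(r',m') -> X_(r,m) *)
Definition res_ok (r' m' r m : int) : bool :=
  [&& r <= r', m <= m', m <= r, m' <= r' & m' <= k].

Lemma res_le (r' m' r m : int) : res_ok r' m' r m -> r <= r'.
Proof. by case/and5P. Qed.

Lemma res_subproof (r' m' r m : int) (h : res_ok r' m' r m) n (z : fibre r' m' n) :
  in_fibre m (bond (res_le h) n (sval z)).
Proof.
case: z => z zP /= h1 h2; have /and5P[h3 h4 h5 h6 h7] := h.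
rewrite -(bond_comp _ _ (le_trans h4 h6)) (bond_comp h6 h4) (zP h6 h7).
by rewrite smap_deg -bond_comp.
Qed.

Program Definition res (r' m' r m : int) (h : res_ok r' m' r m) :
    smap (fibre r' m') (fibre r m) :=
  @SMap (fibre r' m') (fibre r m) (fun n z => exist _ _ (res_subproof h z)) _.
Next Obligation. by apply: eq_exist; rewrite smapE. Qed.

Program Definition pres (r' m' r m : int) (h : res_ok r' m' r m)
    (hr' : r' <= k) (hr : r <= k) : pmap (@pfibre r' m' hr') (@pfibre r m hr) :=
  @PMap (@pfibre r' m' hr') (@pfibre r m hr) (res h) _.
Next Obligation. by apply: eq_exist; rewrite /= -bond_comp. Qed.

(* the fibre sequence X_(e,r) -> X_(e,m) -> X_(r,m) *)
Program Definition fibre_null (r m e : int) (h1 : res_ok e r e m)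
    (h2 : res_ok e m r m) (he : e <= k) (hr : r <= k) :
    pnull (pres h1 he he) (pres h2 he hr) :=
  @PNull _ _ _ (pres h1 he he) (pres h2 he hr)
    (@Htpy _ _ _ _ (fun n z _ => bpt (@pfibre r m hr) n) _ _ _) _.
Next Obligation. by apply: eq_exist; rewrite -/(deg _ _) [RHS]sact_deg. Qed.
Next Obligation.
apply: eq_exist => /=; have /and5P[h3 h4 h5 h6 h7] := h1.
rewrite -(bond_comp _ _ h6) (H h6 h7) /deg; congr (sact _ _).
by congr (bond _ 0 x); apply: bool_irrelevance.
Qed.
Next Obligation. by move=> n t. Qed.

Lemma fibre_point (r : int) (hr : r <= k) n (z : @pfibre r r hr n) : z = bpt _ n.
Proof.
case: z => z zP; apply: eq_exist => /=.
by rewrite -[z](bond_id (lexx r)) (zP _ hr).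
Qed.
End Tower.

Lemma null_loop_subproof (X E B : psset) (i : pmap X E) (p : pmap E B)
  (h : pnull i p) (hE : forall n (z : E n), z = bpt E n) n (z : X n) :
  is_loop (hpath h z : paths B n).
Proof.
by split; rewrite /pend /= ?htpy0 ?htpy1 //= [i _ _]hE pmap_bpt.
Qed.

(* a null homotopic composite X -> * -> B gives a map X -> loop B *)
Program Definition null_loop (X E B : psset) (i : pmap X E) (p : pmap E B)
    (h : pnull i p) (hE : forall n (z : E n), z = bpt E n) : pmap X (loop B) :=
  @PMap X (loop B)
    (@SMap X (loop B) (fun n z => exist _ _ (null_loop_subproof h hE z)) _) _.
Next Obligation. by apply: loop_ext => q s t /=; rewrite sact_comp. Qed.
Next Obligation. by apply: loop_ext => q s t /=; rewrite sact0 pnullb. Qed.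

(** * The truncated assumptions *)

(* Strict maps between the fibrant objects above are general enough: a diagram in
   the homotopy theory of HK-modules can be realized by bifibrant ones. *)

(* Omega^infty and Omega^(infty-1) *)
Notation Om0 M := (lev (hkpre M) (fin 0)).
Notation Om1 M := (lev (hkpre M) (fin 1)).

(* The pairs (r, s) with s >= 0 are encoded by r <= e where e = r + s, so that
   the sequences  F_(r+s,t) -> F_(r,s+t) -> F_(r,s)  become
   F b c -> F a c -> F a b  for a <= b <= c. *)

(* range of F_(r,s): r >= -1 and 0 <= s <= k + 2 *)
Definition F_ok (k r e : int) : bool := [&& -1 <= r, r <= e & e - r <= k + 2].

(* range of F b c -> F a c -> F a b: s + t - 2 <= k, for s = b - a, t = c - b *)
Definition tri_ok (k a b c : int) : bool :=
  [&& -1 <= a, a <= b, b <= c & c - a - 2 <= k].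

(* range of X_(e,m) -> X_(r,m) -> Omega^(infty-1) F r e: with s = e - r, the bound
   s - 2 <= m is dropped for s = 0, 1 *)
Definition cmap_ok (k m r e : int) : bool :=
  [&& -1 <= r, r <= e, m <= r, m <= k & (e - r <= 1) || (e - r - 2 <= m)].

Section Assumptions.
Variables (K : comPzRingType) (T : tower) (k : int) (x : T k 0).

Local Notation "X_( r , m )" := (fibre x r m) (format "X_( r ,  m )").
Local Notation res := (@res T k x _ _ _ _).

Record obstruction_data := ObstructionData {
  F : int -> int -> hkmodule K;
  F_diag : forall r, F_ok k r r -> mcontractible (F r r);
  F_neg : forall r e, F_ok k r e -> e < 0 -> mcontractible (F r e);
  Fseq : forall a b c, tri_ok k a b c -> mfibseq (F b c) (F a c) (F a b);
  Fseq_id1 : forall a c (h : tri_ok k a a c) A n y, mi (Fseq h) A n y = y;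
  Fseq_id2 : forall a b (h : tri_ok k a b b) A n y, mp (Fseq h) A n y = y;
  (* the sequences X_(e,m) -> X_(r,m) -> Omega^(infty-1) F r e *)
  cmap : forall m r e, cmap_ok k m r e -> smap X_(r, m) (Om1 (F r e));
  cnull : forall m r e (h : cmap_ok k m r e) (hres : res_ok k e m r m),
    htpy (scomp (cmap h) (res hres)) (sconst X_(e, m) (Om1 (F r e)));
  c_fibre : forall m r e (h : cmap_ok k m r e) (hres : res_ok k e m r m),
    fibre_seq (cnull h hres);
  (* they are sequences of pointed spaces if X_(e,m) has a base point *)
  cmap_pt : forall m r e (h : cmap_ok k m r e) (hr : r <= k), e <= k ->
    cmap h 0 (pt (pfibre x m hr)) = pt (Om1 (F r e));
  cnull_pt : forall m r e (h : cmap_ok k m r e) (hres : res_ok k e m r m)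
    (he : e <= k) n t,
    cnull h hres n (bpt (pfibre x m he) n) t = bpt (Om1 (F r e)) n;
  (* they are compatible with the inclusions X_(-,m) -> X_(-,m') for m' <= m *)
  c_compat : forall m m' r e (h : cmap_ok k m r e) (h' : cmap_ok k m' r e)
    (hres : res_ok k e m r m) (hres' : res_ok k e m' r m')
    (he : res_ok k e m e m') (hr : res_ok k r m r m'),
    exists (L : htpy (scomp (cmap h') (res hr)) (scomp (pid _) (cmap h)))
           (R : htpy (scomp (res hr) (res hres)) (scomp (res hres') (res he))),
      stationary R /\ coherent (cnull h hres) (cnull h' hres') L R }.

Variable D : obstruction_data.

Definition pcmap m r e (h : cmap_ok k m r e) (hr : r <= k) (he : e <= k) :
    pmap (pfibre x m hr) (Om1 (F D r e)) :=
  @PMap (pfibre x m hr) _ (cmap D h) (cmap_pt D h hr he).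

Definition pcnull m r e (h : cmap_ok k m r e) (hres : res_ok k e m r m)
    (hr : r <= k) (he : e <= k) : pnull (pres x hres he hr) (pcmap h hr he) :=
  @PNull _ _ _ (pres x hres he hr) (pcmap h hr he) (cnull D h hres)
    (cnull_pt D h hres he).

(* The equivalence X_(e,r) -> Omega^infty F r e given by cnull, as a map to the loops of
   Omega^(infty-1) F r e. *)
Definition eqv r e (h : cmap_ok k r r e) (hres : res_ok k e r r r)
    (hr : r <= k) (he : e <= k) : pmap (pfibre x r he) (loop (Om1 (F D r e))) :=
  null_loop (pcnull h hres hr he) (@fibre_point T k x r hr).

(* The map from Omega^(infty-1) F b c to the homotopy fibre of
   Omega^(infty-1) (F a c -> F a b), which exhibits the former as
   Omega^infty of the target of F a b -> Omega^(-1) F b c. *)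
Definition Ffib a b c (h : tri_ok k a b c) :
    pmap (Om1 (F D b c)) (phofib (mp (Fseq D h) (fin 1))) :=
  pfibmap (mlevel (Fseq D h) (fin 1)).

(* The homotopies J filling the squares
     X_(b,m) -> X_(a,m)
        |          |
     Om1 F b c -> Om1 F a c
   are compatible with the null homotopies: the square extends to a map from
   X_(b,m) -> X_(a,m) -> Om1 F a b to Om1 of F b c -> F a c -> F a b, and from
   X_(c,m) -> X_(b,m) -> Om1 F b c to X_(c,m) -> X_(a,m) -> Om1 F a c. *)
Definition square_coherent : Prop :=
  forall m a b c (hF : tri_ok k a b c) (hab : cmap_ok k m a b) (hac : cmap_ok k m a c)
    (hbc : cmap_ok k m b c) (rab : res_ok k b m a m) (rac : res_ok k c m a m)
    (rbc : res_ok k c m b m) (rcc : res_ok k c m c m),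
  c - a - 2 <= m ->
  exists J : htpy (scomp (cmap D hac) (res rab))
                  (scomp (mi (Fseq D hF) (fin 1)) (cmap D hbc)),
    (exists L : htpy (scomp (mp (Fseq D hF) (fin 1)) (cmap D hac))
                     (scomp (pid _) (cmap D hab)),
       coherent (cnull D hab rab) (mlevel (Fseq D hF) (fin 1)) L J) /\
    (exists2 R : htpy (scomp (res rab) (res rbc)) (scomp (res rac) (res rcc)),
       stationary R & coherent (cnull D hbc rbc) (cnull D hac rac) J R).

(* X_(c,a) -> X_(b,a) -> Om1 F b c is Omega^infty of
   F a c -> F a b -> Omega^(-1) F b c *)
Definition fibration_loops : Prop :=
  forall a b c (hF : tri_ok k a b c) (hab : cmap_ok k a a b) (hac : cmap_ok k a a c)
    (hbc : cmap_ok k a b c) (rab : res_ok k b a a a) (rac : res_ok k c a a a)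
    (rbc : res_ok k c a b a) (ha : a <= k) (hb : b <= k) (hc : c <= k),
  c - a - 2 <= a ->
  pcoherent (pcnull hbc rbc hb hc) (rot (mp (Fseq D hF) (fin 1)))
    (eqv hac rac ha hc) (eqv hab rab ha hb) (Ffib hF).

Definition Fseq_compat : Prop :=
  forall a b c d (habc : tri_ok k a b c) (habd : tri_ok k a b d)
    (hacd : tri_ok k a c d) (hbcd : tri_ok k b c d),
  [/\ mhomotopic (fun A => scomp (mp (Fseq D hacd) A) (mi (Fseq D habd) A))
                 (fun A => scomp (mi (Fseq D habc) A) (mp (Fseq D hbcd) A)),
      mhomotopic (fun A => mi (Fseq D hacd) A)
                 (fun A => scomp (mi (Fseq D habd) A) (mi (Fseq D hbcd) A))
    & mhomotopic (fun A => mp (Fseq D habd) A)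
                 (fun A => scomp (mp (Fseq D habc) A) (mp (Fseq D hacd) A))].

Definition loop_ok (m r : int) : bool := [&& -1 <= m, m <= r & r <= m *+ 2 + 3].
Definition loop2_ok (m r : int) : bool := (-1 <= m) && (m <= r).

(* the loops, resp. double loops, of the spaces X_(r,m) and Omega^infty F m r *)
Definition loop_eqvs := forall m r (h : loop_ok m r) (hr : r <= k),
  pmap (loop (pfibre x m hr)) (loop (Om0 (F D m r))).
Definition loop2_eqvs := forall m r (h : loop2_ok m r) (hr : r <= k),
  pmap (loop (loop (pfibre x m hr))) (loop (loop (Om0 (F D m r)))).

(* the structure map Omega^infty M -> loop (Omega^(infty-1) M) *)
Local Notation adj0 M := (adj (hkpre M) (fin 0)).

Definition loop_conditions (phi : loop_eqvs) : Prop :=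
  [/\ (* equivalences *)
      forall m r (h : loop_ok m r) (hr : r <= k), weq (phi m r h hr),
      (* loops of X_(e,r) -> X_(e,m) -> X_(r,m) *)
      forall m r e (hF : tri_ok k m r e) (her : loop_ok r e) (hem : loop_ok m e)
        (hrm : loop_ok m r) (h1 : res_ok k e r e m) (h2 : res_ok k e m r m)
        (he : e <= k) (hr : r <= k),
      pcoherent (loop_null (fibre_null x h1 h2 he hr))
                (loop_null (mlevel (Fseq D hF) (fin 0)))
                (phi r e her he) (phi m e hem he) (phi m r hrm hr),
      (* loops of X_(e,m) -> X_(r,m) -> Om1 F r e *)
      forall m r e (hF : tri_ok k m r e) (hc : cmap_ok k m r e)
        (hem : loop_ok m e) (hrm : loop_ok m r) (h2 : res_ok k e m r m)
        (he : e <= k) (hr : r <= k),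
      pcoherent (loop_null (pcnull hc h2 hr he))
                (loop_null (rot (mp (Fseq D hF) (fin 1))))
                (pcomp (loop_map (adj0 (F D m e))) (phi m e hem he))
                (pcomp (loop_map (adj0 (F D m r))) (phi m r hrm hr))
                (loop_map (Ffib hF))
    & (* the loops of the equivalence X_(e,r) -> Omega^infty F r e *)
      forall r e (hc : cmap_ok k r r e) (her : loop_ok r e) (h2 : res_ok k e r r r)
        (hr : r <= k) (he : e <= k),
      phomotopic (loop_map (eqv hc h2 hr he))
                 (pcomp (loop_map (adj0 (F D r e))) (phi r e her he))].

Definition loop2_conditions (phi : loop_eqvs) (psi : loop2_eqvs) : Prop :=
  [/\ forall m r (h : loop2_ok m r) (hr : r <= k), weq (psi m r h hr),
      forall m r (h : loop2_ok m r) (h' : loop_ok m r) (hr : r <= k),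
        phomotopic (psi m r h hr) (loop_map (phi m r h' hr)),
      (* double loops of X_(e,r) -> X_(e,m) -> X_(r,m) *)
      forall m r e (hF : tri_ok k m r e) (her : loop2_ok r e) (hem : loop2_ok m e)
        (hrm : loop2_ok m r) (h1 : res_ok k e r e m) (h2 : res_ok k e m r m)
        (he : e <= k) (hr : r <= k),
      pcoherent (loop_null (loop_null (fibre_null x h1 h2 he hr)))
                (loop_null (loop_null (mlevel (Fseq D hF) (fin 0))))
                (psi r e her he) (psi m e hem he) (psi m r hrm hr)
    & (* double loops of X_(e,m) -> X_(r,m) -> Om1 F r e *)
      forall m r e (hF : tri_ok k m r e) (hc : cmap_ok k m r e)
        (hem : loop2_ok m e) (hrm : loop2_ok m r) (h2 : res_ok k e m r m)
        (he : e <= k) (hr : r <= k),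
      pcoherent (loop_null (loop_null (pcnull hc h2 hr he)))
                (loop_null (loop_null (rot (mp (Fseq D hF) (fin 1)))))
                (pcomp (loop_map (loop_map (adj0 (F D m e)))) (psi m e hem he))
                (pcomp (loop_map (loop_map (adj0 (F D m r)))) (psi m r hrm hr))
                (loop_map (loop_map (Ffib hF)))].

End Assumptions.

Record truncated_assumptions (K : comPzRingType) (T : tower) (k : int) (x : T k 0) :=
  TruncatedAssumptions {
    obs :> obstruction_data K x;
    obs_square : square_coherent obs;
    obs_fibration : fibration_loops obs;
    obs_Fseq : Fseq_compat obs;
    phi : loop_eqvs obs;
    psi : loop2_eqvs obs;
    obs_loops : loop_conditions phi;
    obs_loops2 : loop2_conditions phi psi }.

(** * The truncated spectral sequence *)

(* The term E_r^(s,t) is indexed by a = s - r, b = s - 1 and n = t - s + 1; thus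
   r = b + 1 - a and s = b + 1.  Its range is 1 <= r <= (k + 3) / 2 and
   s >= 2 r - 3, and F_(s-r,_) must be given. *)
Definition E_ok (k a b : int) : bool :=
  [&& -1 <= a, 1 <= b + 1 - a, 2 * (b + 1 - a) <= k + 3
    & 2 * (b + 1 - a) - 3 <= b + 1].

Lemma E_ok1 k a b : E_ok k a b -> tri_ok k a b (b + 1).
Proof. by rewrite /E_ok /tri_ok => /and4P[*]; apply/and4P; split; lia. Qed.

Lemma E_ok2 k a b : E_ok k a b -> tri_ok k b (b + 1) (b + 1 + (b - a)).
Proof. by rewrite /E_ok /tri_ok => /and4P[*]; apply/and4P; split; lia. Qed.

(* the homology of
   pi_n F_(s-r,r-1) -> pi_(n-1) F_(s-1,1) -> pi_(n-2) F_(s,r-1) *)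
Definition Eterm (K : comPzRingType) (T : tower) (k : int) (x : T k 0)
    (D : obstruction_data K x) (a b : int) (h : E_ok k a b) (n : int) :=
  homology n (Fseq D (E_ok1 h)) (Fseq D (E_ok2 h)).

Lemma E_okP (k l : int) : 0 <= k -> k - 1 <= 2 * l -> l <= k -> E_ok k l k.
Proof. by rewrite /E_ok => *; apply/and4P; split; lia. Qed.

Lemma cmap_ok_last (k : int) : 0 <= k -> cmap_ok k (-1) k (k + 1).
Proof. by rewrite /cmap_ok => *; apply/and5P; split; try apply/orP; lia. Qed.

Lemma le_succ (l k : int) : l <= k -> l <= k + 1.
Proof. lia. Qed.

(* the image of x along X_k -> Omega^(infty-1) F_(k,1), where X_k = X_(k,-1) *)
Definition obstruction (K : comPzRingType) (T : tower) (k : int) (x : T k 0)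
    (D : obstruction_data K x) (hk : 0 <= k) : Om1 (F D k (k + 1)) 0 :=
  cmap D (cmap_ok_last hk) 0 (pt (pfibre x (-1) (lexx k))).

(* Main.v *)
(* Let s = obstruction D hk.  The fibre X_(k+1,l) is the homotopy fibre of
   * = X_(l,l) -> Om1 F_(l,k+1-l), so y exists if and only if this map hits the
   component of the base point.  By the square of (A3) for X_(k,l), its value is
   connected to the image of s under F_(k,1) -> F_(l,k+1-l); and by exactness of the
   sequence of homotopy groups, the latter vanishes if and only if [s] lies in the
   image of the connecting morphism from pi_0 F_(l,k-l).  On the other hand, the
   factorization of X_(k,k) -> Om1 F_(k,1) through Om1 F_(k,k+1-l) makes s a
   cycle. *)
From mathcomp Require Import all_boot all_order all_algebra.
From mathcomp Require Import boolp zify.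
Require Import Defs.

Set Implicit Arguments.
Unset Strict Implicit.
Unset Printing Implicit Defensive.
Import Order.TTheory GRing.Theory Num.Theory.
Local Open Scope ring_scope.

(** * Simplicial maps and horns *)

Lemma mono_natP m n (f g : mono m n) :
  (forall i : 'I_m.+1, f i = g i :> nat) -> f = g.
Proof. by move=> fg; apply: mono_ext => i; apply/val_inj/fg. Qed.

(** A natural number as index leaves the simplicial identities to arithmetic, and unfolding gives
    the faces of [pi_sum]. *)
Definition coface n (i : nat) : mono n n.+1 := mcoface (inord i).

Lemma cofaceE n i (j : 'I_n.+1) : (i <= n.+1)%N -> coface n i j = bump i j :> nat.
Proof. by move=> hi; rewrite /mono_fun /= ffunE /= inordK. Qed.

Lemma codegen_mono n (j : nat) (a b : 'I_n.+2) : (a <= b)%N ->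
  ((inord (minn n (unbump j a)) : 'I_n.+1) <=
   (inord (minn n (unbump j b)) : 'I_n.+1))%N.
Proof. by move=> ab; rewrite !inordK ?ltnS ?geq_minl // /unbump; lia. Qed.

(** The cap [minn n] takes effect for [j] above [n], so that every coface, the last one included,
    has a retraction. *)
Definition codegen n (j : nat) : mono n.+1 n := mk_mono (@codegen_mono n j).

Lemma codegenE n j (i : 'I_n.+2) : codegen n j i = minn n (unbump j i) :> nat.
Proof. by rewrite /mono_fun /= ffunE inordK // ltnS geq_minl. Qed.

Lemma coface_codegen m n j (s : mono m n.+1) : (j <= n.+1)%N ->
  (forall a, s a != j :> nat) -> mcomp (coface n j) (mcomp (codegen n j) s) = s.
Proof.
move=> hj sj; apply: mono_natP => a; rewrite !mcompE cofaceE // codegenE.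
by move: (sj a) (ltn_ord (s a)); rewrite /bump /unbump; lia.
Qed.

Lemma coface_inj m n j (f g : mono m n) : (j <= n.+1)%N ->
  mcomp (coface n j) f = mcomp (coface n j) g -> f = g.
Proof.
move=> hj fg; apply: mono_natP => a.
have := congr1 (fun h : mono m n.+1 => h a : nat) fg.
by rewrite !mcompE !cofaceE // /bump; lia.
Qed.

Lemma coface_neq m n j (f : mono m n) a : (j <= n.+1)%N ->
  mcomp (coface n j) f a != j :> nat.
Proof. by move=> hj; rewrite mcompE cofaceE // eq_sym neq_bump. Qed.

(** The Kan condition in terms of faces. A simplex of the horn misses a vertex [j] other than [i],
    hence lies in the face [j] and gets its value from [y j]; the matching of the faces makes the
    choice of [j] immaterial. *)
Lemma horn_filler (X : sset) (kX : kan X) n i (y : nat -> X n.+1) :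
  (i <= n.+2)%N ->
  (forall j j', (j < j' <= n.+2)%N -> j != i -> j' != i ->
     sact (coface n j'.-1) (y j) = sact (coface n j) (y j')) ->
  exists x : X n.+2, forall j, (j <= n.+2)%N -> j != i ->
    sact (coface n.+1 j) x = y j.
Proof.
move=> hi yE.
(* A simplex in both faces misses [j] and [j'], so it factors through their common face, where [yE]
   applies. *)
have yE_lt j j' m (f g : mono m n.+1) : (j < j' <= n.+2)%N -> j != i -> j' != i ->
    mcomp (coface n.+1 j) f = mcomp (coface n.+1 j') g ->
    sact f (y j) = sact g (y j').
  move=> hj ji j'i fg; have [h1 h2] := andP hj.
  have fgE a : bump j (f a) = bump j' (g a).
    have := congr1 (fun h : mono m n.+2 => h a : nat) fg.
    by rewrite !mcompE !cofaceE //; lia.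
  have gj a : g a != j :> nat by have := fgE a; rewrite /bump; lia.
  have hjn : (j <= n.+1)%N by lia.
  have hj'n : (j'.-1 <= n.+1)%N by lia.
  rewrite -(coface_codegen hjn gj) sact_comp -yE // -sact_comp; congr (sact _ _).
  apply: mono_natP => a; rewrite !mcompE cofaceE // codegenE.
  by move: (fgE a) (ltn_ord (g a)); rewrite /bump /unbump; lia.
have yE_any j j' m (f g : mono m n.+1) : (j <= n.+2)%N -> (j' <= n.+2)%N ->
    j != i -> j' != i -> mcomp (coface n.+1 j) f = mcomp (coface n.+1 j') g ->
    sact f (y j) = sact g (y j').
  move=> hj hj' ji j'i fg; case: (ltngtP j j') => jj'.
  - by apply: (yE_lt j j') => //; rewrite jj'.
  - by apply/esym/(yE_lt j' j) => //; rewrite jj'.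
  - by move: fg; rewrite jj' => fg; rewrite (coface_inj hj' fg).
pose i0 : 'I_n.+3 := inord i.
have i0E : i0 = i :> nat by rewrite inordK.
have hornP m (s : mono m n.+2) : in_horn i0 s ->
    {j : 'I_n.+3 | (j != i0) && [forall a, s a != j]}.
  by move=> h; exists (xchoose (existsP h)); exact: (xchooseP (existsP h)).
have hornP1 m (s : mono m n.+2) (h : in_horn i0 s) : sval (hornP m s h) != i :> nat.
  by case: (hornP _ _ _) => j /= /andP[]; rewrite -val_eqE /= i0E.
have hornP2 m (s : mono m n.+2) (h : in_horn i0 s) :
    mcomp (coface n.+1 (sval (hornP m s h)))
          (mcomp (codegen n.+1 (sval (hornP m s h))) s) = s.
  case: (hornP _ _ _) => j /= /andP[_ /forallP sj].
  by apply: coface_codegen => [|a]; [rewrite -ltnS | exact: sj].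
have hle m (s : mono m n.+2) (h : in_horn i0 s) : (sval (hornP m s h) <= n.+2)%N.
  by rewrite -ltnS.
pose u m (s : mono m n.+2) (h : in_horn i0 s) : X m :=
  sact (mcomp (codegen n.+1 (sval (hornP m s h))) s) (y (sval (hornP m s h))).
have [] := kX n.+1 i0 u tt; [|by []|].
  move=> m m' f s h h'; rewrite /u -sact_comp; apply: yE_any => //.
  by rewrite hornP2 mcompA hornP2.
move=> x xE _; exists x => j hj ji.
have h : in_horn i0 (coface n.+1 j).
  apply/existsP; exists (inord j); rewrite -val_eqE /= i0E inordK // ji /=.
  apply/forallP => a; rewrite -val_eqE /= inordK // -[coface n.+1 j]mcompid.
  exact: coface_neq.
rewrite (xE _ _ h) /u -[RHS]sact_id; apply: yE_any => //.
by rewrite hornP2 mcompid.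
Qed.

(** * The square and its two triangles *)

Lemma msum_mono m (s t : mono m 1) (i j : 'I_m.+1) : (i <= j)%N ->
  ((inord (s i + t i) : 'I_3) <= (inord (s j + t j) : 'I_3))%N.
Proof.
move=> ij; have := monoP s ij; have := monoP t ij.
by move: (ltn_ord (s j)) (ltn_ord (t j)) => *; rewrite !inordK; lia.
Qed.

(** Each of the two triangles of Delta^1 x Delta^1 goes isomorphically onto Delta^2, the diagonal
    becoming the edge 02. *)
Definition msum m (s t : mono m 1) : mono m 2 := mk_mono (@msum_mono m s t).

Lemma msumE m (s t : mono m 1) i : msum s t i = (s i + t i)%N :> nat.
Proof.
rewrite /mono_fun /= ffunE inordK // -/(s i) -/(t i).
by move: (ltn_ord (s i)) (ltn_ord (t i)); lia.
Qed.

Lemma msum_comp m n (s t : mono n 1) (f : mono m n) :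
  mcomp (msum s t) f = msum (mcomp s f) (mcomp t f).
Proof. by apply: mono_natP => i; rewrite mcompE !msumE !mcompE. Qed.

Lemma msum_diag m (s : mono m 1) : msum s s = mcomp (coface 1 1) s.
Proof.
apply: mono_natP => i; rewrite msumE mcompE cofaceE // /bump.
by move: (ltn_ord (s i)); lia.
Qed.

Definition mle m (s t : mono m 1) : bool := [forall i, (s i <= t i)%N].

Lemma mleP m (s t : mono m 1) : reflect (forall i, (s i <= t i)%N) (mle s t).
Proof. exact: forallP. Qed.

(** Simplices of Delta^1 are step functions, compared by the place of their jump. *)
Lemma mle_total m (s t : mono m 1) : mle s t || mle t s.
Proof.
apply/orP; case: (boolP (mle s t)) => [|/forallPn[i ti]]; [by left | right].
apply/mleP => j; case: (leqP i j) => ij.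
  by move: (monoP s ij) (ltn_ord (t j)) ti; lia.
by move: (monoP t (ltnW ij)) (ltn_ord (s i)) ti; lia.
Qed.

Lemma mle_anti m (s t : mono m 1) : mle s t -> mle t s -> s = t.
Proof.
move=> /mleP st /mleP ts; apply: mono_natP => i.
by apply/eqP; rewrite eqn_leq st ts.
Qed.

Lemma mle_comp m n (s t : mono n 1) (f : mono m n) :
  mle s t -> mle (mcomp s f) (mcomp t f).
Proof. by move=> /mleP st; apply/mleP => i; rewrite !mcompE. Qed.

Ltac mono_cases :=
  by apply: mono_natP => -[[|[|[|?]]] ?];
     rewrite ?(mcompE, mcstE, midE) ?(cofaceE, codegenE, msumE)
             ?(mcompE, mcstE, midE) ?(cofaceE, codegenE, msumE).

Lemma coface_src : coface 0 1 = mcst 0 ord0.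
Proof. by mono_cases. Qed.

Lemma coface_tgt : coface 0 0 = mcst 0 ord_max.
Proof. by mono_cases. Qed.

(** * Components and fillers in Kan complexes *)

Lemma connected_map (X Y : sset) (f : smap X Y) (v w : X 0) :
  connected v w -> connected (f 0 v) (f 0 w).
Proof. by case=> e [<- <-]; exists (f 1 e); rewrite !smapE. Qed.

Lemma htpy_connected (X Y : sset) (f g : smap X Y) (H : htpy f g) (v : X 0) :
  connected (f 0 v) (g 0 v).
Proof.
exists (H 1 (deg v 1) (mid 1)); rewrite -!htpyE !sact_deg !deg0.
by rewrite !midcomp htpy0 htpy1.
Qed.

Section Kan.
Variables (X : sset) (kX : kan X).

Lemma fill2_1 (e f : X 1) : sact (coface 0 0) e = sact (coface 0 1) f ->
  exists z : X 2, sact (coface 1 2) z = e /\ sact (coface 1 0) z = f.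
Proof.
move=> ef.
(* The default branch stands for the face 2; at the missing face 1 it is a dummy. *)
have [|j j' hj ji j'i|z zE] :=
  @horn_filler X kX 0 1 (fun j => if j is 0%N then f else e) => //.
  by have [-> ->] : j = 0%N /\ j' = 2 by lia.
by exists z; rewrite !zE.
Qed.

Lemma fill2_0 (e f : X 1) : sact (coface 0 1) e = sact (coface 0 1) f ->
  exists z : X 2, sact (coface 1 2) z = e /\ sact (coface 1 1) z = f.
Proof.
move=> ef.
have [|j j' hj ji j'i|z zE] :=
  @horn_filler X kX 0 0 (fun j => if j is 1%N then f else e) => //.
  by have [-> ->] : j = 1%N /\ j' = 2 by lia.
by exists z; rewrite !zE.
Qed.

Lemma connected_trans (u v w : X 0) :
  connected u v -> connected v w -> connected u w.
Proof.
move=> [e [eu ev]] [f [fv fw]].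
have [|z [ze zf]] := @fill2_1 e f; first by rewrite coface_src coface_tgt ev.
exists (sact (coface 1 1) z); rewrite -eu -fw -ze -zf -!sact_comp.
by split; congr (sact _ _); mono_cases.
Qed.

Lemma connected_sym (u v : X 0) : connected u v -> connected v u.
Proof.
move=> [e [eu ev]].
(* In the triangle with edges 01 = [e] and 02 constant, the edge 12 runs back along [e]. *)
have [|z [ze zf]] := @fill2_0 e (deg u 1).
  by rewrite coface_src eu sact_deg deg0.
exists (sact (coface 1 0) z); rewrite -ev -ze.
split; first by rewrite -!sact_comp; congr (sact _ _); mono_cases.
transitivity (sact (mcst 0 ord_max : mono 0 1) (deg u 1)).
  by rewrite -zf -!sact_comp; congr (sact _ _); mono_cases.
by rewrite sact_deg deg0.
Qed.

(* [tabc] is the face of the tetrahedron 0123 with vertices a, b and c. *)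
Lemma fill3_1 (t012 t013 t123 : X 2) :
  sact (coface 1 0) t012 = sact (coface 1 2) t123 ->
  sact (coface 1 2) t012 = sact (coface 1 2) t013 ->
  sact (coface 1 0) t013 = sact (coface 1 1) t123 ->
  exists t023 : X 2,
    [/\ sact (coface 1 2) t023 = sact (coface 1 1) t012,
        sact (coface 1 0) t023 = sact (coface 1 0) t123
      & sact (coface 1 1) t023 = sact (coface 1 1) t013].
Proof.
move=> e12 e01 e13.
have [|j j' hj ji j'i|z zE] := @horn_filler X kX 1 1
    (fun j => match j with 0%N => t123 | 2 => t013 | _ => t012 end) => //.
  have [[-> ->]|[[-> ->]|[-> ->]]] :
    (j = 0 /\ j' = 2)%N \/ (j = 0 /\ j' = 3)%N \/ (j = 2 /\ j' = 3)%N by lia.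
  - by rewrite /= e13.
  - by rewrite /= e12.
  - by rewrite /= e01.
exists (sact (coface 2 1) z); rewrite -(zE 0)%N // -(zE 2)%N // -(zE 3)%N //.
by rewrite -!sact_comp; split; congr (sact _ _); mono_cases.
Qed.

Lemma fill3_2 (t012 t023 t123 : X 2) :
  sact (coface 1 0) t012 = sact (coface 1 2) t123 ->
  sact (coface 1 1) t012 = sact (coface 1 2) t023 ->
  sact (coface 1 0) t123 = sact (coface 1 0) t023 ->
  exists t013 : X 2,
    [/\ sact (coface 1 2) t013 = sact (coface 1 2) t012,
        sact (coface 1 0) t013 = sact (coface 1 1) t123
      & sact (coface 1 1) t013 = sact (coface 1 1) t023].
Proof.
move=> e12 e02 e23.
have [|j j' hj ji j'i|z zE] := @horn_filler X kX 1 2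
    (fun j => match j with 0%N => t123 | 1 => t023 | _ => t012 end) => //.
  have [[-> ->]|[[-> ->]|[-> ->]]] :
    (j = 0 /\ j' = 1)%N \/ (j = 0 /\ j' = 3)%N \/ (j = 1 /\ j' = 3)%N by lia.
  - by rewrite /= e23.
  - by rewrite /= e12.
  - by rewrite /= e02.
exists (sact (coface 2 2) z); rewrite -(zE 0)%N // -(zE 1)%N // -(zE 3)%N //.
by rewrite -!sact_comp; split; congr (sact _ _); mono_cases.
Qed.

End Kan.

(** * Homotopy fibres and loops *)

Lemma path0E (X : sset) (c : path X 0) p (s : mono p 0) t :
  c p s t = sact t (c 1%N (mcst 1 ord0) (mid 1)).
Proof.
rewrite -pathE midcomp; congr (c _ _ _).
by apply: mono_ext => i; rewrite mcompE ord1 [RHS]ord1.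
Qed.

Program Definition path_edge (X : sset) (e : X 1) : path X 0 :=
  @Path X 0 (fun p _ t => sact t e) _.
Next Obligation. by rewrite sact_comp. Qed.

Section Square.
Variables (X : sset) (L U : X 2).
Hypothesis LU : sact (coface 1 1) L = sact (coface 1 1) U.

(* Delta^1 x Delta^1 is the union of the triangle [t <= s], here sent to L, and
   of the triangle [s <= t], here sent to U. *)
Definition square_fun p (s t : mono p 1) : X p :=
  if mle t s then sact (msum s t) L else sact (msum s t) U.

Lemma square_le p (s t : mono p 1) : mle t s -> square_fun s t = sact (msum s t) L.
Proof. by rewrite /square_fun => ->. Qed.

Lemma square_ge p (s t : mono p 1) : mle s t -> square_fun s t = sact (msum s t) U.
Proof.
rewrite /square_fun; case: ifP => // ts st.
by rewrite (mle_anti st ts) msum_diag !sact_comp LU.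
Qed.

Lemma square_subproof p q (f : mono p q) (s t : mono q 1) :
  square_fun (mcomp s f) (mcomp t f) = sact f (square_fun s t).
Proof.
by case/orP: (mle_total s t) => st; have st' := mle_comp f st;
  rewrite ?(square_ge st) ?(square_ge st') ?(square_le st) ?(square_le st')
          -msum_comp sact_comp.
Qed.

Definition square : path X 1 := @Path X 1 square_fun square_subproof.

End Square.

Section Hofib.
Variables (E : sset) (B : psset) (p : smap E B).

Definition hedge (z : hofib p 0) : B 1 := (sval z).2 1%N (mcst 1 ord0) (mid 1).

Lemma hedge_src (z : hofib p 0) : sact (coface 0 1) (hedge z) = p 0%N (sval z).1.
Proof.
have [z0 _] := proj2_sig z; rewrite -z0 /hedge /pend -pathE.
by congr ((sval z).2 _ _ _); mono_cases.
Qed.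

Lemma hedge_tgt (z : hofib p 0) : sact (coface 0 0) (hedge z) = pt B.
Proof.
have [_ z1] := proj2_sig z; rewrite -[RHS]deg0 -/(bpt B 0) -z1 /hedge /pend -pathE.
by congr ((sval z).2 _ _ _); mono_cases.
Qed.

(* An edge of the homotopy fibre is an edge e of E and a square in B, with sides
   p e, the base point and the paths of the end points, cut along its diagonal. *)
Lemma hofib_connectedP (a b : hofib p 0) :
  connected a b <->
  exists (e : E 1) (L U : B 2),
    [/\ sact (coface 0 1) e = (sval a).1, sact (coface 0 0) e = (sval b).1
      & [/\ sact (coface 1 1) L = sact (coface 1 1) U, sact (coface 1 2) L = p 1%N e,
            sact (coface 1 0) U = bpt B 1, sact (coface 1 2) U = hedge a
          & sact (coface 1 0) L = hedge b]].
Proof.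
split=> [[z [<- <-]]|[e [L [U [ea eb [LU Le Ub Ua Lb]]]]]].
  have [z0 z1] := proj2_sig z.
  (* The pairs of degeneracies are the triangles (0,0),(1,0),(1,1) and (0,0),(0,1),(1,1) of the
     square. *)
  exists (sval z).1, ((sval z).2 2 (codegen 1 1) (codegen 1 0)),
    ((sval z).2 2 (codegen 1 0) (codegen 1 1)).
  rewrite coface_src coface_tgt -z0 -z1 /hedge /pend -!pathE /= !mcompcst !mcstE.
  by do 2![split=> //]; congr ((sval z).2 _ _ _); mono_cases.
pose c := square LU.
have cP : in_hofib p ((e, c) : sprod E (paths B) 1).
  split; rewrite /= /pend.
    rewrite -Le [LHS]square_le; last by apply/mleP => i; rewrite mcstE.
    by congr (sact _ _); mono_cases.
  rewrite -Ub [LHS](square_ge LU); last first.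
    by apply/mleP => i; rewrite mcstE -ltnS ltn_ord.
  by congr (sact _ _); mono_cases.
exists (exist _ _ cP); split; apply: hofib_ext => /=.
- by rewrite -ea coface_src.
- move=> q s t; rewrite path0E -/(hedge a) -Ua mcstcomp -sact_comp.
  rewrite (square_ge LU); last by apply/mleP => i; rewrite mcstE.
  congr (sact _ U); apply: mono_natP => i.
  by rewrite msumE mcompE mcstE cofaceE // /bump; case: (t i) => -[|[|]].
- by rewrite -eb coface_tgt.
- move=> q s t; rewrite path0E -/(hedge b) -Lb mcstcomp -sact_comp.
  rewrite square_le; last by apply/mleP => i; rewrite mcstE -ltnS ltn_ord.
  congr (sact _ L); apply: mono_natP => i.
  by rewrite msumE mcompE mcstE cofaceE // /bump; case: (t i) => -[|[|]].
Qed.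

(* [connected] is only an edge, so two of them have to be composed in the homotopy
   fibre itself: over a 2-simplex T of E that composes the edges, the prism
   Delta^2 x Delta^1 in B is filled in three tetrahedra, of which W, V and Y are the
   new faces. *)
Lemma hofib_trans (a b c : hofib p 0) : kan E -> kan B ->
  connected a b -> connected b c -> connected a c.
Proof.
move=> kE kB /hofib_connectedP[e [L [U [ea eb [LU Le Ub Ua Lb]]]]].
move=> /hofib_connectedP[e' [L' [U' [eb' ec' [LU' Le' Ub' Ub'' Lc']]]]].
have [|T [Te Te']] := fill2_1 kE (e := e) (f := e'); first by rewrite eb eb'.
(* Let the prism have bottom a0 b0 c0, which is [p T], and constant top a1 b1 c1. The tetrahedra are
   a0 b0 c0 c1, a0 b0 b1 c1 and a0 a1 b1 c1; [z] is the face a0 b0 c1 common to the first two, and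
   [V] is the face a0 b1 c1 common to the last two. *)
have [|z [ze ze']] := fill2_1 kB (e := p 1%N e) (f := sact (coface 1 1) L').
  rewrite -smapE eb -[LHS]/(p 0%N (sval b).1) -eb' smapE -Le' -!sact_comp.
  by congr (sact _ _); mono_cases.
have [|||W [W2 W0 W1]] := @fill3_1 B kB (p 2 T) z L'.
- by rewrite -smapE Te' Le'.
- by rewrite -smapE Te ze.
- by [].
have [|||V [V2 V0 V1]] := @fill3_1 B kB L z U'.
- by rewrite Lb Ub''.
- by rewrite Le ze.
- by rewrite ze' LU'.
have [|||Y [Y2 Y0 Y1]] := @fill3_2 B kB U V (bpt B 2).
- by rewrite Ub sact_deg.
- by rewrite V2 LU.
- by rewrite V0 Ub' sact_deg.
apply/hofib_connectedP; exists (sact (coface 1 1) T), W, Y.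
split.
- rewrite -ea -Te -!sact_comp; congr (sact _ _); mono_cases.
- rewrite -ec' -Te' -!sact_comp; congr (sact _ _); mono_cases.
split.
- by rewrite W1 Y1 V1.
- by rewrite W2 smapE.
- by rewrite Y0 sact_deg.
- by rewrite Y2.
- by rewrite W0.
Qed.

Lemma hofib_connected_fst (a b : hofib p 0) :
  connected a b -> connected (sval a).1 (sval b).1.
Proof.
move=> /hofib_connectedP[e [_ [_ [ea eb _]]]]; exists e.
by rewrite -coface_src -coface_tgt.
Qed.

End Hofib.

(** Glued along its long edge to a degenerate triangle on [d], the triangle [z] becomes a square
    with two constant sides, that is, an edge of the loop space. *)
Lemma loop_connected (Y : psset) (c d : loop Y 0) (z : Y 2) :
  sact (coface 1 2) z = loop_edge c -> sact (coface 1 0) z = bpt Y 1 ->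
  sact (coface 1 1) z = loop_edge d -> connected c d.
Proof.
move=> zc z0 zd.
pose L := sact (codegen 1 0) (loop_edge d).
have LU : sact (coface 1 1) L = sact (coface 1 1) z.
  rewrite zd /L -sact_comp -[RHS]sact_id; congr (sact _ _); mono_cases.
have eP : is_loop (square LU : paths Y 1).
  split; rewrite /= /pend /=.
    rewrite [LHS]square_le; last by apply/mleP => i; rewrite mcstE.
    have [d0 _] := proj2_sig d; move: d0; rewrite /pend /= => d0.
    transitivity (sact (mcst 1 ord0 : mono 1 0) (bpt Y 0)); last by rewrite sact_deg.
    rewrite -d0 /L /loop_edge -sact_comp -!pathE; congr ((sval d) _ _ _); mono_cases.
  rewrite [LHS](square_ge LU); last first.
    by apply/mleP => i; rewrite mcstE -ltnS ltn_ord.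
  by rewrite -z0; congr (sact _ _); mono_cases.
exists (exist _ _ eP); split; apply: loop_ext => q s t /=.
  rewrite path0E -/(loop_edge c) -zc mcstcomp -sact_comp.
  rewrite (square_ge LU); last by apply/mleP => i; rewrite mcstE.
  congr (sact _ z); apply: mono_natP => i.
  by rewrite msumE mcompE mcstE cofaceE // /bump; case: (t i) => -[|[|]].
rewrite path0E -/(loop_edge d) /L mcstcomp.
rewrite square_le; last by apply/mleP => i; rewrite mcstE -ltnS ltn_ord.
rewrite -sact_comp; congr (sact _ _); apply: mono_natP => i.
by rewrite mcompE codegenE msumE mcstE /unbump; case: (t i) => -[|[|]].
Qed.

Lemma edge_loop (B : psset) (e : B 1) :
  sact (coface 0 1) e = pt B -> sact (coface 0 0) e = pt B ->
  exists c : loop B 0, loop_edge c = e.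
Proof.
move=> e0 e1.
have eP : is_loop (path_edge e : paths B 0).
  by rewrite /is_loop /pend /= -coface_src -coface_tgt e0 e1 /bpt deg0.
by exists (exist _ _ eP); rewrite /loop_edge /= sact_id.
Qed.

Lemma loop_edge_tgt (B : psset) (c : loop B 0) :
  sact (mcst 1 ord_max) (loop_edge c) = bpt B 1.
Proof.
have [_ c1] := proj2_sig c; rewrite /pend in c1.
transitivity (sact (mcst 1 ord0 : mono 1 0) (bpt B 0)); last by rewrite sact_deg.
by rewrite -c1 /loop_edge -!pathE; congr ((sval c) _ _ _); mono_cases.
Qed.

(** * Exactness of loop B -> F -> E on components *)

Section Exactness.
Variables (F E B : psset) (i : pmap F E) (p : pmap E B) (h : pnull i p).

Lemma connecting_null (c : loop B 0) (v : F 0) :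
  connected (hinc p 0%N c) (pfibmap h 0%N v) -> connected (pt E) (i 0%N v).
Proof. by move=> /hofib_connected_fst; rewrite /= /bpt deg0. Qed.

Lemma null_connecting (v : F 0) : kan B -> connected (pt E) (i 0%N v) ->
  exists c : loop B 0, connected (hinc p 0%N c) (pfibmap h 0%N v).
Proof.
move=> kB [e []]; rewrite -coface_src -coface_tgt => e0 e1.
pose g := hedge (pfibmap h 0%N v).
have [|z [ze zg]] := fill2_1 kB (e := p 1%N e) (f := g).
  by rewrite -smapE e1 hedge_src.
have [||c cE] := @edge_loop B (sact (coface 1 1) z).
- transitivity (sact (coface 0 1) (p 1%N e)); last by rewrite -smapE e0 pmapE.
  by rewrite -ze -!sact_comp; congr (sact _ _); mono_cases.
- rewrite -[RHS](hedge_tgt (pfibmap h 0%N v)) -/g -zg -!sact_comp.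
  by congr (sact _ _); mono_cases.
exists c; apply/hofib_connectedP; exists e, z, (sact (codegen 1 1) (loop_edge c)).
split; rewrite ?e0 ?e1 /=; [by rewrite /bpt deg0 | by [] |split => //].
- by rewrite cE -sact_comp -[LHS]sact_id -!sact_comp; congr (sact _ _); mono_cases.
- by rewrite -sact_comp -(loop_edge_tgt c); congr (sact _ _); mono_cases.
- by rewrite -sact_comp -[RHS]sact_id; congr (sact _ _); mono_cases.
Qed.

End Exactness.

Lemma weq_connected (X Y : sset) (f : smap X Y) (v w : X 0) :
  weq f -> kan X -> connected (f 0%N v) (f 0%N w) -> connected v w.
Proof.
move=> [g [[H] _]] kX fvw.
apply: (connected_trans kX (v := g 0%N (f 0%N v))).
  exact/(connected_sym kX)/(htpy_connected H).
apply: (connected_trans kX (v := g 0%N (f 0%N w))); first exact: connected_map.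
exact: (htpy_connected H).
Qed.

Lemma weq_surj (X Y : sset) (f : smap X Y) (w : Y 0) :
  weq f -> exists v : X 0, connected (f 0%N v) w.
Proof. by move=> [g [_ [H]]]; exists (g 0%N w); exact: (htpy_connected H). Qed.

(** * The homology of the connecting morphisms *)

Lemma rot_connected (B C : psset) (q : pmap B C) (c : loop B 0) :
  connected (hinc q 0%N (loop_map q 0%N c)) (pt (phofib q)).
Proof. by rewrite -[pt _]deg0; exact: (htpy_connected (rot q) c). Qed.

Section Homology.
Variables (K : comPzRingType) (F E B F' E' : hkmodule K).
Variables (S : mfibseq F E B) (S' : mfibseq F' E' F).

Lemma adj_surj (M : hkmodule K) (A : finType) (c : loop (M (unit + A)%type) 0) :
  exists u : M A 0, connected (adj M A 0%N u) c.
Proof. exact/weq_surj/hk_omega. Qed.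

Lemma heq_zeroP (c : homology 0 S S') :
  heq c (hzero 0 S S') <->
  connected (pt (E (fin 1))) (mi S (fin 1) 0%N (hrep c)).
Proof.
have kM (M : hkmodule K) A : kan (M A) by exact: hk_kan.
split=> [[u [v [/connecting_null uv [z [zv z0 zc]]]]]|].
  apply: (connected_trans (@kM _ _) uv); apply: (connected_map (mi S (fin 1))).
  apply: (weq_connected (hk_omega F (fin 1)) (@kM F (fin 1))).
  apply: (loop_connected (z := z)) => //.
  by rewrite [LHS]z0 pmapE.
move=> /null_connecting-/(_ _ _ (mlevel S (fin 1)) (@kM _ _))[d dP].
have [u uP] := adj_surj d.
exists u, (hrep c); split.
  apply: (@hofib_trans _ _ _ _ _ _ (@kM _ _) (@kM _ _) _ dP).
  exact: (connected_map (hinc (mp S (fin 1)))).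
pose e := loop_edge (adj F (fin 1) 0%N (hrep c)).
exists (sact (codegen 1 1) e); split.
- rewrite -sact_comp -[RHS]sact_id; congr (sact _ _); mono_cases.
- transitivity (bpt (F (fin 2)) 1); last by rewrite pmapE.
  rewrite -sact_comp -[RHS](loop_edge_tgt (adj F (fin 1) 0%N (hrep c))) -/e.
  by congr (sact _ _); mono_cases.
- rewrite -sact_comp -[RHS]sact_id; congr (sact _ _); mono_cases.
Qed.

Lemma conn_image_zero (w : E' (fin 1) 0) (v : F (fin 1) 0) :
  connected v (mp S' (fin 1) 0%N w) -> conn (n := -1) S' v (pt (F' (fin 2))).
Proof.
have kM (M : hkmodule K) A : kan (M A) by exact: hk_kan.
move=> vw; rewrite /conn pmapE.
pose c := loop_map (mp S' (fin 2)) 0%N (adj E' (fin 1) 0%N w).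
apply: (@hofib_trans _ _ _ _ (hinc (mp S' (fin 2)) 0%N c) _ (@kM _ _) (@kM _ _)).
  apply: (connected_map (hinc (mp S' (fin 2)))).
  have -> : c = adj F (fin 1) 0%N (mp S' (fin 1) 0%N w).
    by apply: loop_ext => q s t /=; rewrite mmap_act smapE.
  exact: (connected_map (adj F (fin 1))).
exact: rot_connected.
Qed.
End Homology.

(** * The obstruction *)

Section Obstruction.
Variables (K : comPzRingType) (T : tower) (k : int) (hk : 0 <= k) (x : T k 0%N).
Variable D : obstruction_data K x.

Lemma res_pt r m m' (h : res_ok k r m r m') (hr : r <= k) :
  res x h 0%N (pt (pfibre x m hr)) = pt (pfibre x m' hr).
Proof. by apply: eq_exist => /=; rewrite bond_id. Qed.

Lemma obstruction_fibre m (h : cmap_ok k m k (k + 1)) : -1 <= m ->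
  connected (obstruction D hk) (cmap D h 0%N (pt (pfibre x m (lexx k)))).
Proof.
move=> hm; have hmk : m <= k by case/and5P: h.
have r1 : res_ok k (k + 1) m k m by apply/and5P; split; lia.
have r2 : res_ok k (k + 1) (-1) k (-1) by apply/and5P; split; lia.
have r3 : res_ok k (k + 1) m (k + 1) (-1) by apply/and5P; split; lia.
have r4 : res_ok k k m k (-1) by apply/and5P; split; lia.
have [L _] := c_compat D h (cmap_ok_last hk) r1 r2 r3 r4.
rewrite /obstruction -(res_pt r4 (lexx k)).
exact: (htpy_connected L (pt (pfibre x m (lexx k)))).
Qed.

Lemma lift_connectedP l (hlk : l <= k) (h : cmap_ok k l l (k + 1)) :
  (exists y : T (k + 1) 0%N, bond (le_succ hlk) 0%N y = bond hlk 0%N x) <->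
  connected (cmap D h 0%N (pt (pfibre x l hlk))) (pt (Om1 (F D l (k + 1)))).
Proof.
have hr : res_ok k (k + 1) l l l by apply/and5P; split; lia.
split=> [[y yx]|[q [q0 q1]]].
  have yP : in_fibre x l y.
    move=> h1 h2; rewrite (bool_irrelevance h1 (le_succ hlk)) yx deg0.
    by rewrite (bool_irrelevance h2 hlk).
  pose z : fibre x (k + 1) l 0 := exist _ y yP.
  have -> : pt (pfibre x l hlk) = res x hr 0%N z.
    by rewrite [RHS](@fibre_point _ _ _ l hlk 0 _) /bpt deg0.
  by rewrite -[pt _]deg0; exact: (htpy_connected (cnull D h hr) z).
have [g _] := c_fibre D h hr.
pose z : sprod (fibre x l l) (paths _) 0 := (pt (pfibre x l hlk), path_edge q).
have zP : in_hofib (cmap D h) z.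
  by rewrite /in_hofib /z /pend /= q0 q1 /bpt deg0.
have [y yP] := g 0%N (exist _ z zP).
by exists y; rewrite (yP (le_succ hlk) hlk) deg0.
Qed.

Lemma obstruction_push_zeroP l (hl : k - 1 <= 2 * l) (hlk : l <= k)
    (hF : tri_ok k l k (k + 1)) (h : cmap_ok k l l (k + 1)) : square_coherent D ->
  connected (pt (Om1 (F D l (k + 1))))
    (mi (Fseq D hF) (fin 1) 0%N (obstruction D hk)) <->
  exists y : T (k + 1) 0%N, bond (le_succ hlk) 0%N y = bond hlk 0%N x.
Proof.
move=> sq; rewrite (lift_connectedP hlk h).
have hab : cmap_ok k l l k by apply/and5P; split; lia.
have hbc : cmap_ok k l k (k + 1) by apply/and5P; split; lia.
have rab : res_ok k k l l l by apply/and5P; split; lia.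
have rac : res_ok k (k + 1) l l l by apply/and5P; split; lia.
have rbc : res_ok k (k + 1) l k l by apply/and5P; split; lia.
have rcc : res_ok k (k + 1) l (k + 1) l by apply/and5P; split; lia.
have [|J _] := sq l l k (k + 1) hF hab h hbc rab rac rbc rcc; first by lia.
have ptE : res x rab 0%N (pt (pfibre x l (lexx k))) = pt (pfibre x l hlk).
  by rewrite [LHS](@fibre_point _ _ _ l hlk 0 _) /bpt deg0.
have JE : connected (cmap D h 0%N (pt (pfibre x l hlk)))
    (mi (Fseq D hF) (fin 1) 0%N (cmap D hbc 0%N (pt (pfibre x l (lexx k))))).
  by rewrite -ptE; exact: (htpy_connected J (pt (pfibre x l (lexx k)))).
have hm : -1 <= l by lia.
have oE := connected_map (mi (Fseq D hF) (fin 1)) (obstruction_fibre hbc hm).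
have kM : kan (Om1 (F D l (k + 1))) by exact: hk_kan.
have JoE := connected_trans kM JE (connected_sym kM oE).
split=> [po|op].
  exact: connected_trans JoE (connected_sym kM po).
exact: connected_trans (connected_sym kM op) JoE.
Qed.

Lemma obstruction_lift (c : int) (hF : tri_ok k k (k + 1) c) : c - k - 2 <= k ->
  square_coherent D ->
  exists w : Om1 (F D k c) 0,
    connected (obstruction D hk) (mp (Fseq D hF) (fin 1) 0%N w).
Proof.
move=> hc sq; have /and4P[h1 h2 h3 h4] := hF.
have hab : cmap_ok k k k (k + 1) by apply/and5P; split; lia.
have hac : cmap_ok k k k c by apply/and5P; split; lia.
have hbc : cmap_ok k k (k + 1) c by apply/and5P; split; lia.
have rab : res_ok k (k + 1) k k k by apply/and5P; split; lia.
have rac : res_ok k c k k k by apply/and5P; split; lia.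
have rbc : res_ok k c k (k + 1) k by apply/and5P; split; lia.
have rcc : res_ok k c k c k by apply/and5P; split; lia.
have [_ [[L _] _]] := sq k k (k + 1) c hF hab hac hbc rab rac rbc rcc hc.
exists (cmap D hac 0%N (pt (pfibre x k (lexx k)))).
have kM : kan (Om1 (F D k (k + 1))) by exact: hk_kan.
have hm : -1 <= k by lia.
apply: (connected_trans kM (obstruction_fibre hab hm)).
exact: (connected_sym kM (htpy_connected L _)).
Qed.

End Obstruction.

Theorem proposition5p4 (K : comPzRingType) (T : tower) (k : int) (hk : 0 <= k)
    (x : T k 0%N) (D : truncated_assumptions K x)
    (l : int) (hl : k - 1 <= 2 * l) (hlk : l <= k) :
  exists e : Eterm D (E_okP hk hl hlk) 0,
    hrep e = obstruction D hk /\
    (heq e (hzero 0 _ _) <->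
     exists y : T (k + 1) 0%N, bond (le_succ hlk) 0%N y = bond hlk 0%N x).
Proof.
have h : cmap_ok k l l (k + 1) by apply/and5P; split; lia.
have [|w wP] := obstruction_lift hk (E_ok2 (E_okP hk hl hlk)) _ (obs_square D).
  by lia.
exists (Homology (n := 0) (Fseq D (E_ok1 (E_okP hk hl hlk))) (conn_image_zero wP)).
split=> //; rewrite heq_zeroP /=.
exact: (obstruction_push_zeroP hk hl hlk _ h (obs_square D)).
Qed.
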